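(* Let $C$ be an arbitrary bivariate copula and let $(U_1,V_1),(U_2,V_2),\dots$ be independent copies of a random vector $(U,V)$ with distribution function $C$. For $n\in\mathbb{N}$ let $U_{1:n}\le\dots\le U_{n:n}$ and $V_{1:n}\le\dots\le V_{n:n}$ denote the order statistics of $U_1,\dots,U_n$ and of $V_1,\dots,V_n$, respectively. Let $X,Y,\eta_j$ be independent random variables, where $X$ and $Y$ are standard normal and, for $j\in\mathbb{N}$, $\eta_j$ has distribution function $G_j(x)=\exp(x)\sum_{i=0}^{j-1}\frac{(-x)^i}{i!}$, $x\le 0$. Let $k=k(n)$, $j=j(n)\in\{1,\dots,n\}$, $n\in\mathbb{N}$. Then the following hold, where $\to_D$ denotes convergence in distribution as $n\to\infty$. (i) If $k\to_{n\to\infty}\infty$ and $k/n\to_{n\to\infty}0$, then, for fixed $j\in\mathbb{N}$, $$\left(\frac{n}{\sqrt{k}}\left(U_{n-k+1:n}-\frac{n-k+1}{n+1}\right),\ n\left(V_{n-j+1:n}-1\right)\right)\to_D (X,\eta_j).$$ (ii) If $k\to_{n\to\infty}\infty$ and $k/n\to_{n\to\infty}0$, then, for fixed $j\in\mathbb{N}$, $$\left(\frac{n}{\sqrt{k}}\left(U_{k:n}-\frac{k}{n+1}\right),\ n\left(V_{n-j+1:n}-1\right)\right)\to_D (X,\eta_j).$$ (iii) If $k/n\to_{n\to\infty}\lambda\in(0,1)$ and $j\in\mathbb{N}$ is fixed, then $$\left(\sqrt{n}\left(U_{k:n}-\frac{k}{n+1}\right),\ n\left(V_{n-j+1:n}-1\right)\right)\to_D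 \left((\lambda(1-\lambda))^{1/2}X,\ \eta_j\right).$$ (iv) If $k/n\to_{n\to\infty}\lambda\in(0,1)$, $j\to_{n\to\infty}\infty$ and $j/n\to_{n\to\infty}0$, then $$\left(\sqrt{n}\left(U_{k:n}-\frac{k}{n+1}\right),\ \frac{n}{\sqrt{j}}\left(V_{n-j+1:n}-\frac{n-j+1}{n+1}\right)\right)\to_D \left((\lambda(1-\lambda))^{1/2}X,\ Y\right).$$ (v) If $k\to_{n\to\infty}\infty$, $k/n\to_{n\to\infty}0$, $j\to_{n\to\infty}\infty$, $j/n\to_{n\to\infty}0$ and, in addition, $j/\sqrt{k}\to_{n\to\infty}0$, then $$\left(\frac{n}{\sqrt{k}}\left(U_{n-k+1:n}-\frac{n-k+1}{n+1}\right),\ \frac{n}{\sqrt{j}}\left(V_{n-j+1:n}-\frac{n-j+1}{n+1}\right)\right)\to_D (X,Y).$$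
   Context: A bivariate copula $C$ is the joint distribution function of a random vector $(U,V)$ such that $U$ and $V$ are each uniformly distributed on $(0,1)$. Order statistics are taken componentwise: $U_{r:n}$ is the $r$-th smallest of $U_1,\dots,U_n$, and $V_{k:n}$ is the $k$-th smallest of $V_1,\dots,V_n$. The distribution function $G_j$ equals $1$ for $x>0$. *)

(* Defs.v *)
From HB Require Import structures.
From mathcomp Require Export all_boot all_order all_algebra.
From mathcomp Require Export all_classical all_reals all_analysis.

Set Implicit Arguments.
Unset Strict Implicit.
Unset Printing Implicit Defensive.

Import Order.TTheory GRing.Theory Num.Theory.
Import numFieldNormedType.Exports.

Local Open Scope classical_set_scope.
Local Open Scope ring_scope.

Definition mutually_independent {d d'} {T : measurableType d}
    {E : measurableType d'} {R : realType} (P : probability T R)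
    {I : choiceType} (X : I -> T -> E) : Prop :=
  forall (s : seq I) (A : I -> set E), uniq s -> (forall i, measurable (A i)) ->
    P (\bigcap_(i in [set` s]) X i @^-1` A i) =
    (\prod_(i <- s) P (X i @^-1` A i))%E.

(* Laws are compared on measurable sets only: a probability is a function on
   all sets, but its values on non-measurable ones are meaningless. *)
Definition has_law {d} {T : measurableType d} {R : realType}
    {P : probability T R} (X : {RV P >-> R}) (mu : set R -> \bar R) : Prop :=
  forall A : set R, measurable A -> distribution P X A = mu A.

Definition joint_cdf {d} {T : measurableType d} {R : realType}
    (P : probability T R) (Z : T -> R * R) (p : R * R) : \bar R :=
  P [set w | (Z w).1 <= p.1 /\ (Z w).2 <= p.2].

Definition is_copula {R : realType} (C : R * R -> R) : Prop :=
  exists (d : measure_display) (T : measurableType d) (P : probability T R)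
    (U V : {RV P >-> R}),
    [/\ has_law U (uniform_prob (@ltr01 R)),
        has_law V (uniform_prob (@ltr01 R)) &
        forall p, joint_cdf P (fun w => (U w, V w)) p = (C p)%:E].

(* The r-th smallest, 1 <= r <= n, of the first n terms of the sequence X,
   which are X 0, ..., X (n - 1). *)
Definition order_stat {T : Type} {R : realType} (X : nat -> T -> R)
    (r n : nat) (w : T) : R :=
  nth 0 (sort <=%R [seq X i w | i <- iota 0 n]) r.-1.

(* Pointwise convergence of the joint distribution functions at the continuity
   points of the limit. Measurability is required because Z n is not bundled
   as a random vector. *)
Definition cvg_in_distribution {d d'} {T : measurableType d}
    {T' : measurableType d'} {R : realType}
    (P : probability T R) (Z : nat -> T -> R * R)
    (P' : probability T' R) (L : T' -> R * R) : Prop :=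
  [/\ forall n, measurable_fun setT (Z n),
      measurable_fun setT L &
      forall p : R * R, {for p, continuous (joint_cdf P' L)} ->
        joint_cdf P (Z n) p @[n --> \oo] --> joint_cdf P' L p].

Definition neg_gamma_cdf {R : realType} (j : nat) (x : R) : R :=
  if x <= 0 then expR x * \sum_(0 <= i < j) (- x) ^+ i / i`!%:R else 1.

(* Main.v *)
(* For real s, t, the event U_(r:n) <= s, V_(m:n) <= t says that at least r of
   the U_i are <= s and at least m of the V_i are <= t, so everything is about
   the joint law of two correlated binomial counts with success probabilities
   s and t.

   Asymptotic independence.  For functions f, g of the two counts with
   increments bounded by L and M, exchanging one pair of indicators at a time
   gives |Cov(f, g)| <= n |C(s,t) - st| L M, and |C(s,t) - st| <= 1 - t.
   Indicators of tails are replaced by ramps of width w, at the price of the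
   probability that a count falls in a window of width w, which is O(w / sd).
   In all five regimes w can be chosen so that both errors vanish.

   Marginals.  The tail probability of a binomial law has, as a function of the
   success probability, derivative proportional to s^a (1 - s)^b.  Rescaled
   around its mode this density is bounded by e^((1 - |x|)/2) and tends to
   e^(-x^2/2), so dominated convergence gives the normal limit, and the total
   mass fixes the constant.  Extreme order statistics of V give the Poisson limit
   of the number of V_i > t. *)

Require Import Defs.
From mathcomp Require Import ring lra zify measurable_realfun.

Set Implicit Arguments.
Unset Strict Implicit.
Unset Printing Implicit Defensive.

Import Order.TTheory GRing.Theory Num.Theory.
Import numFieldNormedType.Exports.

Local Open Scope classical_set_scope.
Local Open Scope ring_scope.

(** * Binomial expectations *)

(** The expectations are defined by recursion on the number of trials, so that differentiation in
    the success probability, the exchange of one pair of indicators and the passage from random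
    pairs to counts are each one induction on [n]. The obstacle is that n times [C(s,t) - st] need
    not vanish: it is only bounded when [j] is fixed, and of order [j] otherwise, so sharp
    indicators, with increments 1, give no useful bound. Ramps divide it by the two widths. With [A]
    and [A'] the smaller of the numbers of successes and failures at the two thresholds, widths
    [e sqrt A] and [e sqrt A'] leave an error of order [sqrt (A' / A) / e^2], besides window
    probabilities of order [e]; here [e] is fixed before [n] grows. This is why the first threshold
    has to be the more central one, which in (v) follows from [j / sqrt k -> 0]. When [j] is fixed
    the second indicator stays sharp. No Stirling formula enters: the constant of a binomial density
    is bounded because probabilities are at most 1. *)

Fixpoint binE (R : realType) (p : R) (n : nat) (f : nat -> R) : R :=
  if n is n'.+1 then p * binE p n' (f \o S) + (1 - p) * binE p n' f else f 0%N.

(** [p] is the law of one pair of indicators; the arguments of [F] count how often the first and the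
    second of them are true. *)
Fixpoint binE2 (R : realType) (p : bool -> bool -> R) (n : nat)
    (F : nat -> nat -> R) : R :=
  if n is n'.+1 then
    p true true * binE2 p n' (fun a b => F a.+1 b.+1) +
    p true false * binE2 p n' (fun a b => F a.+1 b) +
    p false true * binE2 p n' (fun a b => F a b.+1) +
    p false false * binE2 p n' F
  else F 0%N 0%N.

Section binomial_expectation.
Context {R : realType}.
Implicit Types (p : R) (f g : nat -> R) (n : nat).

Lemma eq_binE p n f g : (forall m, (m <= n)%N -> f m = g m) ->
  binE p n f = binE p n g.
Proof.
elim: n f g => [|n IH] f g fg /=; first exact: fg.
by congr (_ * _ + _ * _); apply: IH => m mn; apply: fg; lia.
Qed.

Lemma binE_cst p n (c : R) : binE p n (fun=> c) = c.
Proof.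
elim: n => //= n IH; rewrite (_ : (fun=> c) \o S = fun=> c)// IH; ring.
Qed.

Lemma binED p n f g : binE p n (fun m => f m + g m) = binE p n f + binE p n g.
Proof.
elim: n f g => //= n IH f g.
rewrite (_ : (fun m => f m + g m) \o S = fun m => (f \o S) m + (g \o S) m)//.
rewrite !IH; ring.
Qed.

Lemma binEZ p n (c : R) f : binE p n (fun m => c * f m) = c * binE p n f.
Proof.
elim: n f => //= n IH f.
rewrite (_ : (fun m => c * f m) \o S = fun m => c * (f \o S) m)//.
rewrite !IH; ring.
Qed.

Lemma binEB p n f g : binE p n (fun m => f m - g m) = binE p n f - binE p n g.
Proof.
rewrite (_ : (fun m => f m - g m) = fun m => f m + (-1) * g m); last first.
  by apply/funext => m; rewrite mulN1r.
by rewrite binED binEZ mulN1r.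
Qed.

Lemma binE_sum p n (I : Type) (s : seq I) (f : I -> nat -> R) :
  binE p n (fun m => \sum_(i <- s) f i m) = \sum_(i <- s) binE p n (f i).
Proof.
elim: s => [|i s IH].
  rewrite big_nil -[RHS](binE_cst p n); apply: eq_binE => m _.
  by rewrite big_nil.
rewrite big_cons -IH -binED; apply: eq_binE => m _.
by rewrite big_cons.
Qed.

Lemma binE_le p n f g : 0 <= p <= 1 -> (forall m, f m <= g m) ->
  binE p n f <= binE p n g.
Proof.
move=> /andP[p0 p1]; elim: n f g => //= n IH f g fg.
by rewrite lerD// ler_wpM2l// ?subr_ge0//; apply: IH => m /=.
Qed.

Lemma binE_ge0 p n f : 0 <= p <= 1 -> (forall m, 0 <= f m) -> 0 <= binE p n f.
Proof. by move=> p01 f0; rewrite -(binE_cst p n 0); exact: binE_le. Qed.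

Lemma binE_le1 p n f : 0 <= p <= 1 -> (forall m, f m <= 1) -> binE p n f <= 1.
Proof. by move=> p01 f0; rewrite -(binE_cst p n 1); exact: binE_le. Qed.

Lemma binE_norm_le p n f (L : R) : 0 <= p <= 1 -> (forall m, `|f m| <= L) ->
  `|binE p n f| <= L.
Proof.
move=> p01 fL; rewrite ler_norml -{1}(binE_cst p n (- L)) -{2}(binE_cst p n L).
by apply/andP; split; apply: binE_le => // m; have := fL m; rewrite ler_norml => /andP[].
Qed.

Lemma binE_reflect p n f :
  binE p n f = binE (1 - p) n (fun m => f (n - m)%N).
Proof.
elim: n f => //= n IH f.
rewrite addrC !IH subKr; congr (_ + _ * _).
by apply: eq_binE => m mn /=; congr f; lia.
Qed.

Lemma binE_eq p n i :
  binE p n (fun m => (m == i)%:R) = 'C(n, i)%:R * p ^+ i * (1 - p) ^+ (n - i).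
Proof.
elim: n i => [|n IH] i /=.
  by case: i => [|i]; rewrite ?bin0 ?bin0n /= ?mul0r// !expr0 !mulr1.
rewrite IH; case: i => [|i].
  rewrite (_ : _ \o _ = fun=> 0) // binE_cst !bin0 subn0 exprS; ring.
rewrite (_ : _ \o _ = fun m => (m == i)%:R) // IH binS natrD subSS.
case: (ltnP i n) => ni.
  by rewrite (_ : (n - i = (n - i.+1).+1)%N) ?[p ^+ i.+1]exprS ?[(1 - p) ^+ _.+1]exprS; [ring|lia].
by rewrite (_ : 'C(n, i.+1) = 0%N) ?[p ^+ _.+1]exprS; [ring|rewrite bin_small].
Qed.

Lemma binE_p0 n f : binE 0 n f = f 0%N.
Proof. by elim: n => //= n ->; rewrite mul0r subr0 mul1r add0r. Qed.

Lemma binE_p1 n f : binE 1 n f = f n.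
Proof. by elim: n f => //= n IH f; rewrite IH subrr mul0r mul1r addr0. Qed.

(** Each of the [n] trials contributes the effect of flipping its own indicator, an average of
    [f m.+1 - f m] over the other trials. *)
Lemma is_derive_binE n f p :
  is_derive p 1 (fun x : R => binE x n f)
    (n%:R * binE p n.-1 (fun m => f m.+1 - f m)).
Proof.
elim: n f => [|n IH] f /=.
  by rewrite mul0r; exact: is_derive_cst.
have h1 := IH (f \o S); have h2 := IH f.
have -> : (fun x : R => x * binE x n (f \o S) + (1 - x) * binE x n f) =
  (@id R) * (fun x : R => binE x n (f \o S)) +
  (cst 1 - @id R) * (fun x : R => binE x n f) by [].
have e := is_deriveD (is_deriveM (is_derive_id p (1 : R)) h1)
  (is_deriveM (is_deriveB (is_derive_cst (1 : R) p (1 : R)) (is_derive_id p (1 : R))) h2).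
apply: (is_derive_eq e); clear e h1 h2.
rewrite /= /GRing.scale /=.
have -> : binE p n (fun m => f m.+1 - f m) = binE p n (f \o S) - binE p n f by rewrite -binEB.
case: n {IH} => [|n] /=; first by ring.
set u := binE _ _ (fun m => (_ \o S) m.+1 - _).
have -> : u = binE p n (fun m => f m.+2) - binE p n (f \o S).
  by rewrite -binEB.
rewrite binEB.
rewrite [in RHS]mulrBr [n.+2%:R]mulrS.
have -> : binE p n ((f \o S) \o S) = binE p n (fun m => f m.+2) by [].
have -> : (cst 1 - id) p = 1 - p by [].
ring.
Qed.

Lemma binE_shift_le p n f (L : R) : 0 <= p <= 1 ->
  (forall m, `|f m.+1 - f m| <= L) -> `|binE p n (f \o S) - binE p n f| <= L.
Proof. by move=> p01 fL; rewrite -binEB; exact: binE_norm_le. Qed.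

End binomial_expectation.

(** * Covariance of functions of two correlated counts *)

Section joint_binomial_expectation.
Context {R : realType}.
Variable p : bool -> bool -> R.
Hypothesis p_ge0 : forall a b, 0 <= p a b.
Hypothesis p_sum1 : p true true + p true false + p false true + p false false = 1.
Implicit Types (f g : nat -> R) (F G : nat -> nat -> R).

Let p1 := p true true + p true false.
Let q1 := p true true + p false true.

Let p1_01 : 0 <= p1 <= 1.
Proof.
have := p_ge0 true true; have := p_ge0 true false.
have := p_ge0 false true; have := p_ge0 false false.
by move: p_sum1; rewrite /p1; lra.
Qed.

Let q1_01 : 0 <= q1 <= 1.
Proof.
have := p_ge0 true true; have := p_ge0 true false.
have := p_ge0 false true; have := p_ge0 false false.
by move: p_sum1; rewrite /q1; lra.
Qed.

Lemma binE2_le n F G : (forall a b, F a b <= G a b) ->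
  binE2 p n F <= binE2 p n G.
Proof.
elim: n F G => [|n IH] F G FG /=; first exact: FG.
by rewrite !lerD// ler_wpM2l//; apply: IH.
Qed.

Lemma binE2D n F G :
  binE2 p n (fun a b => F a b + G a b) = binE2 p n F + binE2 p n G.
Proof.
elim: n F G => [|n IH] F G //=.
rewrite (IH (fun a b => F a.+1 b.+1) (fun a b => G a.+1 b.+1)).
rewrite (IH (fun a b => F a.+1 b) (fun a b => G a.+1 b)).
rewrite (IH (fun a b => F a b.+1) (fun a b => G a b.+1)) IH; ring.
Qed.

Lemma binE2_fst n f : binE2 p n (fun a _ => f a) = binE p1 n f.
Proof.
elim: n f => [|n IH] f //=; rewrite (IH f) (IH (f \o S)).
have -> : 1 - p1 = p false true + p false false by rewrite -p_sum1 /p1; ring.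
rewrite /p1; ring.
Qed.

Lemma binE2_snd n g : binE2 p n (fun _ b => g b) = binE q1 n g.
Proof.
elim: n g => [|n IH] f //=; rewrite (IH f) (IH (f \o S)).
have -> : 1 - q1 = p true false + p false false by rewrite -p_sum1 /q1; ring.
rewrite /q1; ring.
Qed.

(* The last pair of indicators contributes [p true true - p1 * q1] times one
   increment of each factor; all other terms are averages of the smaller case. *)
Lemma binE2_cov n f g (L M : R) : (forall m, `|f m.+1 - f m| <= L) ->
  (forall m, `|g m.+1 - g m| <= M) ->
  `|binE2 p n (fun a b => f a * g b) - binE p1 n f * binE q1 n g|
  <= n%:R * (`|p true true - p1 * q1| * (L * M)).
Proof.
elim: n f g => [|n IH] f g fL gM; first by rewrite /= subrr normr0 mul0r.
have fL' m : `|(f \o S) m.+1 - (f \o S) m| <= L by exact: fL.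
have gM' m : `|(g \o S) m.+1 - (g \o S) m| <= M by exact: gM.
have h11 : `|binE2 p n (fun a b => f a.+1 * g b.+1) - _| <= _ := IH _ _ fL' gM'.
have h10 : `|binE2 p n (fun a b => f a.+1 * g b) - _| <= _ := IH _ _ fL' gM.
have h01 : `|binE2 p n (fun a b => f a * g b.+1) - _| <= _ := IH _ _ fL gM'.
have h00 := IH _ _ fL gM.
have hx := binE_shift_le n p1_01 fL; have hy := binE_shift_le n q1_01 gM.
rewrite /=; move: h11 h10 h01 h00 hx hy.
set x1 := binE p1 n (f \o S); set x0 := binE p1 n f.
set y1 := binE q1 n (g \o S); set y0 := binE q1 n g.
set e11 := binE2 _ _ _; set e10 := binE2 _ _ _.
set e01 := binE2 _ _ _; set e00 := binE2 _ _ _.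
set e := n%:R * _ => h11 h10 h01 h00 hx hy.
have -> : p true true * e11 + p true false * e10 + p false true * e01 +
    p false false * e00 -
    (p1 * x1 + (1 - p1) * x0) * (q1 * y1 + (1 - q1) * y0) =
  p true true * (e11 - x1 * y1) + p true false * (e10 - x1 * y0) +
  p false true * (e01 - x0 * y1) + p false false * (e00 - x0 * y0) +
  (p true true - p1 * q1) * ((x1 - x0) * (y1 - y0)).
  have -> : p false false = 1 - p true true - p true false - p false true.
    by rewrite -p_sum1; ring.
  rewrite /p1 /q1; ring.
have hp a b u : `|u| <= e -> `|p a b * u| <= p a b * e.
  by move=> ue; rewrite normrM ger0_norm// ler_wpM2l.
have hxy : `|(p true true - p1 * q1) * ((x1 - x0) * (y1 - y0))| <=
    `|p true true - p1 * q1| * (L * M).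
  by rewrite !normrM ler_wpM2l// ler_pM.
have -> : n.+1%:R * (`|p true true - p1 * q1| * (L * M)) =
    p true true * e + p true false * e + p false true * e + p false false * e +
    `|p true true - p1 * q1| * (L * M).
  by rewrite -!mulrDl p_sum1 /e -natr1; ring.
do ![apply: (le_trans (ler_normD _ _)); apply: lerD => //]; exact: hp.
Qed.

End joint_binomial_expectation.

(** * Smoothing of tail indicators *)

Section smoothing.
Context {R : realType}.

Definition tail_ind (r m : nat) : R := (r <= m)%N%:R.

(** Piecewise linear, 1 from [r] on and 0 up to [r - w] by truncated subtraction. Writing
    [m + w - r] and not [m - (r - w)] keeps the slope at the inverse of [w] when [w > r]. *)
Definition ramp (r w m : nat) : R := (minn w (m + w - r))%:R / w%:R.

(** The places where the ramp may exceed the indicator. It is empty for [w = 1], when the ramp is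
    the indicator itself; extreme order statistics rely on this. *)
Definition window (r w m : nat) : R := ((r < m + w) && (m < r))%N%:R.

Lemma tail_ind_ge0 r m : 0 <= tail_ind r m. Proof. exact: ler0n. Qed.

Lemma tail_ind_le1 r m : tail_ind r m <= 1.
Proof. by rewrite /tail_ind; case: (r <= m)%N. Qed.

Lemma ramp_le1 r w m : (0 < w)%N -> ramp r w m <= 1.
Proof.
move=> w0; rewrite /ramp ler_pdivrMr ?ltr0n// mul1r ler_nat; exact: geq_minl.
Qed.

Lemma tail_le_ramp r w m : (0 < w)%N -> tail_ind r m <= ramp r w m.
Proof.
move=> w0; rewrite /tail_ind /ramp; case: leqP => rm.
  by rewrite (minn_idPl _) ?divff ?pnatr_eq0 -?lt0n//; lia.
by rewrite divr_ge0.
Qed.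

Lemma ramp_sub_tail r w m : (0 < w)%N -> ramp r w m - tail_ind r m <= window r w m.
Proof.
move=> w0; rewrite /tail_ind /window; case: (leqP r m) => rm.
  by rewrite andbF subr_le0 ramp_le1.
rewrite andbT subr0; case: ltnP => rw; first exact: ramp_le1.
by rewrite /ramp (_ : m + w - r = 0)%N ?minn0 ?mul0r//; lia.
Qed.

Lemma ramp_lip r w m : (0 < w)%N -> `|ramp r w m.+1 - ramp r w m| <= w%:R^-1.
Proof.
move=> w0; rewrite /ramp -mulrBl normrM [`|_^-1|]ger0_norm ?invr_ge0//.
rewrite ler_piMl ?invr_ge0// -natrB; last by lia.
by rewrite ger0_norm// (_ : 1 = 1%:R)// ler_nat; lia.
Qed.

(** Replacing both indicators by ramps costs at most the sum of the two window probabilities, once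
    in the joint expectation and once in the product of expectations; hence the factor 2. *)
Lemma tail_cov (p : bool -> bool -> R) n r r' w w' :
  let p1 := p true true + p true false in
  let q1 := p true true + p false true in
  (forall a b, 0 <= p a b) ->
  p true true + p true false + p false true + p false false = 1 ->
  (0 < w)%N -> (0 < w')%N ->
  `|binE2 p n (fun a b => tail_ind r a * tail_ind r' b) -
    binE p1 n (tail_ind r) * binE q1 n (tail_ind r')| <=
  n%:R * `|p true true - p1 * q1| / (w%:R * w'%:R) +
  (binE p1 n (window r w) + binE q1 n (window r' w')) *+ 2.
Proof.
move=> p1 q1 p0 psum w0 w'0.
have p01 : 0 <= p1 <= 1.
  have := p0 true true; have := p0 true false.
  by have := p0 false true; have := p0 false false; move: psum; rewrite /p1; lra.
have q01 : 0 <= q1 <= 1.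
  have := p0 true true; have := p0 true false.
  by have := p0 false true; have := p0 false false; move: psum; rewrite /q1; lra.
have cov := binE2_cov p0 psum n (fun m => ramp_lip r m w0) (fun m => ramp_lip r' m w'0).
(* Stated for arbitrary reals because it serves twice: for values at a point and for
   expectations. *)
have aux (t u t' u' W W' : R) : 0 <= t -> t <= u -> u - t <= W -> u <= 1 ->
    0 <= t' -> t' <= u' -> u' - t' <= W' -> u' <= 1 ->
    t * t' <= u * u' /\ u * u' <= t * t' + (W + W').
  by move=> *; split; nra.
have h2 a b := aux _ _ _ _ _ _ (tail_ind_ge0 r a) (tail_le_ramp r a w0)
  (ramp_sub_tail r a w0) (ramp_le1 r a w0) (tail_ind_ge0 r' b)
  (tail_le_ramp r' b w'0) (ramp_sub_tail r' b w'0) (ramp_le1 r' b w'0).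
have hB (u : R) s v : 0 <= u <= 1 -> (0 < v)%N ->
  [/\ 0 <= binE u n (tail_ind s), binE u n (tail_ind s) <= binE u n (ramp s v),
     binE u n (ramp s v) - binE u n (tail_ind s) <= binE u n (window s v) &
     binE u n (ramp s v) <= 1].
  move=> u01 v0; split.
  - by apply: binE_ge0 => // m; exact: tail_ind_ge0.
  - by apply: binE_le => // m; exact: tail_le_ramp.
  - by rewrite -binEB; apply: binE_le => // m; exact: ramp_sub_tail.
  - by apply: binE_le1 => // m; exact: ramp_le1.
have [a1 a2 a3 a4] := hB _ r w p01 w0.
have [b1 b2 b3 b4] := hB _ r' w' q01 w'0.
have [c1 c2] := aux _ _ _ _ _ _ a1 a2 a3 a4 b1 b2 b3 b4.
have d1 : binE2 p n (fun a b => tail_ind r a * tail_ind r' b) <=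
    binE2 p n (fun a b => ramp r w a * ramp r' w' b).
  by apply: binE2_le => // a b; have [] := h2 a b.
have d2 : binE2 p n (fun a b => ramp r w a * ramp r' w' b) <=
    binE2 p n (fun a b => tail_ind r a * tail_ind r' b) +
    (binE p1 n (window r w) + binE q1 n (window r' w')).
  rewrite -(binE2_fst psum) -(binE2_snd psum) -!binE2D.
  by apply: binE2_le => // a b; have [] := h2 a b.
have -> : n%:R * `|p true true - p1 * q1| / (w%:R * w'%:R) =
    n%:R * (`|p true true - p1 * q1| * (w%:R^-1 * w'%:R^-1)).
  by rewrite invfM !mulrA.
move: cov; rewrite -/p1 -/q1 !ler_norml => /andP[e1 e2].
by rewrite mulr2n; apply/andP; split; lra.
Qed.

End smoothing.

(** * The normal limit *)

Section logarithm_bounds.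
Context {R : realType}.
Implicit Types (t v : R).

Lemma is_derive_ln1D t : -1 < t -> is_derive t 1 (fun x : R => ln (1 + x)) (1 + t)^-1.
Proof.
move=> t1; have t0 : 0 < 1 + t by lra.
have e := is_deriveD (is_derive_cst (1 : R) t (1 : R)) (is_derive_id t (1 : R)).
by apply: (is_derive_eq (is_derive1_comp (is_derive1_ln t0) e)); rewrite add0r mulr1.
Qed.

Lemma derivable_within_continuous_itv (f df : R -> R) (a b : R) :
  (forall t, a <= t <= b -> is_derive t 1 f (df t)) -> {within `[a, b], continuous f}.
Proof.
move=> fd; apply: derivable_within_continuous => t; rewrite in_itv/= => tab.
by have [] := fd _ tab.
Qed.

(** [t * dg t <= 0] says that [g] decreases when moving away from 0 in either direction, so that one
    statement serves both signs of [v]; the other two conditions place [t] strictly between 0 and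
    [v]. *)
Lemma le0_derive_sign (g dg : R -> R) v : -1 < v ->
  (forall t, -1 < t -> is_derive t 1 g (dg t)) ->
  (forall t, -1 < t -> 0 < t * v -> `|t| < `|v| -> t * dg t <= 0) ->
  g 0 = 0 -> g v <= 0.
Proof.
move=> v1 gd dgs g0; have [v0|v0|->] := ltgtP v 0; last by rewrite g0.
- have [||c] := @MVT R g dg v 0 v0.
  + by move=> x; rewrite in_itv/= => /andP[vx _]; apply: gd; lra.
  + by apply: (@derivable_within_continuous_itv _ dg) => t /andP[vt _]; apply: gd; lra.
  rewrite in_itv/= => /andP[vc c0]; rewrite g0 => h.
  have : c * dg c <= 0.
    by apply: dgs; [lra|nra|rewrite !ltr0_norm//; lra].
  by nra.
- have [||c] := @MVT R g dg 0 v v0.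
  + by move=> x; rewrite in_itv/= => /andP[vx _]; apply: gd; lra.
  + by apply: (@derivable_within_continuous_itv _ dg) => t /andP[vt _]; apply: gd; lra.
  rewrite in_itv/= => /andP[vc c0]; rewrite g0 => h.
  have : c * dg c <= 0.
    by apply: dgs; [lra|nra|rewrite !gtr0_norm//; lra].
  by nra.
Qed.

Let is_derive_sqr t : is_derive t 1 (fun x : R => x ^+ 2) (2 * t).
Proof.
apply: (is_derive_eq (is_deriveX 2 (is_derive_id t (1 : R)))).
by rewrite /GRing.scale/= expr1 mulr1.
Qed.

Let is_derive_ln_quad (a b : R) t : -1 < t ->
  is_derive t 1 (fun x : R => ln (1 + x) + (a * x + b * x ^+ 2))
    ((1 + t)^-1 + (a + b * (2 * t))).
Proof.
move=> t1.
have e := is_deriveD (is_derive_ln1D t1) (is_deriveD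
  (is_deriveM (is_derive_cst a t (1 : R)) (is_derive_id t (1 : R)))
  (is_deriveM (is_derive_cst b t (1 : R)) (is_derive_sqr t))).
by apply: (is_derive_eq e); rewrite /GRing.scale/=; ring.
Qed.

(** The left-hand difference has derivative t^2 / (1 + t), at most 2 v^2 between 0 and [v] because 1
    + t >= 1/2; the mean value theorem supplies the third factor. *)
Lemma ln1D_sub_quad_bound v : `|v| <= 2^-1 ->
  `|ln (1 + v) - v + v ^+ 2 / 2| <= 2 * `|v| ^+ 3.
Proof.
move=> hv; pose g (x : R) : R := ln (1 + x) + (-1 * x + 2^-1 * x ^+ 2).
pose dg (t : R) : R := (1 + t)^-1 + (-1 + 2^-1 * (2 * t)).
have hgv : ln (1 + v) - v + v ^+ 2 / 2 = g v by rewrite /g; ring.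
have g0 : g 0 = 0 by rewrite /g expr0n /= !mulr0 !addr0 ln1.
have gd t : -1 < t -> is_derive t 1 g (dg t) by exact: is_derive_ln_quad.
have dgE t : -1 < t -> dg t = t ^+ 2 / (1 + t).
  by move=> t1; rewrite /dg; field; lra.
have dgb t : `|t| <= `|v| -> `|dg t| <= 2 * `|v| ^+ 2.
  move=> tv; have t2 : `|t| <= 2^-1 by exact: le_trans hv.
  have /andP[t3 t4] : - 2^-1 <= t <= 2^-1 by rewrite -ler_norml.
  rewrite dgE; last by lra.
  rewrite normrM normrX [`|_^-1|]ger0_norm ?invr_ge0; last by lra.
  rewrite mulrC ler_pM ?exprn_ge0 ?invr_ge0//; first by lra.
    by rewrite invf_ple ?posrE; lra.
  by rewrite lerXn2r ?nnegrE.
rewrite hgv; have /andP[v1 v2] : - 2^-1 <= v <= 2^-1 by rewrite -ler_norml.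
have [v0|v0|v0] := ltgtP v 0.
- have [||c] := @MVT R g dg v 0 v0.
  + by move=> x; rewrite in_itv/= => /andP[vx _]; apply: gd; lra.
  + by apply: (@derivable_within_continuous_itv _ dg) => t /andP[vt _]; apply: gd; lra.
  rewrite in_itv/= g0 !sub0r => /andP[vc c0] h.
  rewrite -normrN h normrM normrN exprSr mulrA ler_wpM2r//; apply: dgb.
  by rewrite !ltr0_norm//; lra.
- have [||c] := @MVT R g dg 0 v v0.
  + by move=> x; rewrite in_itv/= => /andP[vx _]; apply: gd; lra.
  + by apply: (@derivable_within_continuous_itv _ dg) => t /andP[vt _]; apply: gd; lra.
  rewrite in_itv/= g0 !subr0 => /andP[vc c0] h.
  rewrite h normrM exprSr mulrA ler_wpM2r//; apply: dgb.
  by rewrite !gtr0_norm//; lra.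
- by rewrite v0 g0 normr0 mulr_ge0// exprn_ge0.
Qed.

(** The difference of the two sides has derivative t (1 + 2t) / (1 + t), whose sign is that of [t]
    exactly as long as t > -1/2. *)
Lemma ln1D_ge v : - 2^-1 <= v -> v - v ^+ 2 <= ln (1 + v).
Proof.
move=> v2; pose g (x : R) : R := - (ln (1 + x) + (-1 * x + 1 * x ^+ 2)).
have -> : (v - v ^+ 2 <= ln (1 + v)) = (g v <= 0).
  by rewrite /g oppr_le0 -subr_ge0; congr (_ <= _); ring.
apply: (@le0_derive_sign g (fun t => - ((1 + t)^-1 + (-1 + 1 * (2 * t))))).
- by lra.
- by move=> t t1; have := is_deriveN (is_derive_ln_quad (-1) 1 t1).
- move=> t t1 tv tlt.
  have t0 : 0 < 1 + t by lra.
  have -> : t * - ((1 + t)^-1 + (-1 + 1 * (2 * t))) = - (t ^+ 2 * (2 * (1 + t) - 1) / (1 + t)).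
    by field; lra.
  rewrite oppr_le0 divr_ge0//; last by lra.
  apply: mulr_ge0; first exact: sqr_ge0.
  have : - 2^-1 <= t; last by lra.
  have [v0|v0] := leP 0 v; first by nra.
  have tn : t < 0 by nra.
  by move: tlt; rewrite !ltr0_norm//; lra.
- by rewrite /g expr0n /= !mulr0 !addr0 ln1 oppr0.
Qed.

(* Unlike [ln (1 + v) <= v - v^2 / 2], which fails for [0 < v], this holds for
   every [v > -1], and yields the integrable majorant in the normal limit. *)
Lemma ln1D_le_sqr v : -1 < v -> ln (1 + v) <= v - v ^+ 2 / (2 * (1 + `|v|)).
Proof.
move=> v1; have [v0|v0] := leP 0 v.
  rewrite ger0_norm// -subr_le0.
  pose g (x : R) : R := ln (1 + x) + (- 2^-1 * x + 0 * x ^+ 2)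
    + (2^-1 * (1 + x)^-1 - 2^-1).
  (* Division turns v^2 / (1 + v) into v - 1 + 1 / (1 + v), which is easier to differentiate. *)
  have -> : ln (1 + v) - (v - v ^+ 2 / (2 * (1 + v))) = g v.
    by rewrite /g; field; lra.
  apply: (@le0_derive_sign g (fun t => (1 + t)^-1 + (- 2^-1 + 0 * (2 * t))
    - 2^-1 * (1 + t) ^- 2)) => //.
  - move=> t t1; have t0 : 1 + t != 0 by lra.
    have e1 := is_deriveD (is_derive_cst (1 : R) t (1 : R)) (is_derive_id t (1 : R)).
    have e2 := is_deriveM (is_derive_cst (2^-1 : R) t (1 : R)) (is_deriveV t0 e1).
    have e := is_deriveD (is_derive_ln_quad (- 2^-1) 0 t1)
      (is_deriveB e2 (is_derive_cst (2^-1 : R) t (1 : R))).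
    apply: (is_derive_eq e); rewrite /GRing.scale/=.
    ring.
  - move=> t t1 tv _.
    have t0 : 0 < 1 + t by lra.
    have -> : t * ((1 + t)^-1 + (- 2^-1 + 0 * (2 * t)) - 2^-1 * (1 + t) ^- 2) =
        - (t * (t / (1 + t)) ^+ 2 / 2) by field; lra.
    by rewrite oppr_le0 divr_ge0// mulr_ge0 ?sqr_ge0//; nra.
  - by rewrite /g addr0 invr1 expr0n /= !mulr0 mulr1 subrr !addr0 ln1.
(* For negative [v] the stronger bound v - v^2 / 2 holds, and the denominator 1 + |v| >= 1 only
   weakens it. *)
pose g (x : R) : R := ln (1 + x) + (-1 * x + 2^-1 * x ^+ 2).
have : g v <= 0.
  apply: (@le0_derive_sign g (fun t => (1 + t)^-1 + (-1 + 2^-1 * (2 * t)))) => //.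
  - by move=> t; exact: is_derive_ln_quad.
  - move=> t t1 tv _; have t0 : 0 < 1 + t by lra.
    have -> : t * ((1 + t)^-1 + (-1 + 2^-1 * (2 * t))) = t * (t ^+ 2 / (1 + t)) by field; lra.
    by rewrite nmulr_rle0 ?divr_ge0 ?sqr_ge0//; [lra|nra].
  - by rewrite /g expr0n /= !mulr0 !addr0 ln1.
rewrite /g => gv; rewrite (le_trans (_ : _ <= v - 2^-1 * v ^+ 2))//; first by lra.
rewrite lerB// mulrC ler_wpM2r ?sqr_ge0// invf_ple ?posrE ?invrK; last by [].
- by have := normr_ge0 v; lra.
- by have := normr_ge0 v; lra.
Qed.

End logarithm_bounds.

(** * Bounds on the rescaled density *)

Section kernel_bounds.
Context {R : realType}.
Variables (a b : nat) (al be : R).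
Hypothesis al01 : 0 <= al <= 1.
Hypothesis be01 : 0 <= be <= 1.
Hypothesis first_order : a%:R * al = b%:R * be.
Hypothesis second_order : a%:R * al ^+ 2 + b%:R * be ^+ 2 = 1.

(** This is s^a (1 - s)^b around its maximiser, divided by the maximum. [first_order] says that the
    derivative of its logarithm vanishes at 0, and [second_order] that the second derivative there
    is -1. *)
Definition kernel (x : R) : R := (1 + x * al) ^+ a * (1 - x * be) ^+ b.

Lemma expr_expR (n : nat) (y : R) : 0 < y -> y ^+ n = expR (n%:R * ln y).
Proof. by move=> y0; rewrite expRM_natl lnK. Qed.

Lemma kernelE x : 0 < 1 + x * al -> 0 < 1 - x * be ->
  kernel x = expR (a%:R * ln (1 + x * al) + b%:R * ln (1 + - (x * be))).
Proof. by move=> h1 h2; rewrite /kernel !expr_expR// expRD. Qed.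

(** Add [ln1D_le_sqr] at x al and at - x be. Since al and be are at most 1, both denominators are at
    most 2 (1 + |x|); then the linear terms cancel and the quadratic ones sum to x^2. *)
Lemma kernel_le x : (0 < a)%N -> (0 < b)%N ->
  0 <= 1 + x * al -> 0 <= 1 - x * be ->
  kernel x <= expR (- (x ^+ 2 / (2 * (1 + `|x|)))).
Proof.
(* At the edge of the domain a factor is 0 and so is its positive power; the logarithmic form covers
   only the interior. *)
move=> a0 b0; rewrite le_eqVlt => /orP[/eqP e _|h1].
  by rewrite /kernel -e expr0n gtn_eqF// mul0r expR_ge0.
rewrite le_eqVlt => /orP[/eqP e|h2].
  by rewrite /kernel -e expr0n gtn_eqF// mulr0 expR_ge0.
rewrite kernelE// ler_expR.
have x0 := normr_ge0 x.
have key v (n : nat) : -1 < v -> `|v| <= `|x| ->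
    n%:R * ln (1 + v) <= n%:R * v - n%:R * v ^+ 2 / (2 * (1 + `|x|)).
  move=> v1 vx; rewrite -mulrA -mulrBr ler_wpM2l//.
  rewrite (le_trans (ln1D_le_sqr v1))// lerB// ler_wpM2l ?sqr_ge0//.
  by rewrite lef_pV2 ?posrE; have := normr_ge0 v; lra.
have k1 : a%:R * ln (1 + x * al) <= a%:R * (x * al) - a%:R * (x * al) ^+ 2 / (2 * (1 + `|x|)).
  apply: key; first lra.
  by case/andP: al01 => ? ?; rewrite normrM ler_piMr// ger0_norm.
have k2 : b%:R * ln (1 + - (x * be)) <=
    b%:R * (- (x * be)) - b%:R * (- (x * be)) ^+ 2 / (2 * (1 + `|x|)).
  apply: key; first lra.
  by case/andP: be01 => ? ?; rewrite normrN normrM ler_piMr// ger0_norm.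
apply: (le_trans (lerD k1 k2)); rewrite le_eqVlt; apply/orP; left; apply/eqP.
transitivity (x * (a%:R * al - b%:R * be)
  - x ^+ 2 * (a%:R * al ^+ 2 + b%:R * be ^+ 2) / (2 * (1 + `|x|))); first by ring.
by rewrite first_order second_order subrr mulr0 mulr1 add0r.
Qed.

Lemma kernel_le1 x : (0 < a)%N -> (0 < b)%N ->
  0 <= 1 + x * al -> 0 <= 1 - x * be -> kernel x <= 1.
Proof.
move=> *; apply: (le_trans (kernel_le _ _ _ _)) => //.
by rewrite -expR0 ler_expR oppr_le0 divr_ge0 ?sqr_ge0// mulr_ge0// addr_ge0.
Qed.

(** x^2 / (1 + |x|) >= |x| - 1, which yields an integrable bound that does not depend on [a] and
    [b]. *)
Lemma kernel_le_exp x : (0 < a)%N -> (0 < b)%N ->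
  0 <= 1 + x * al -> 0 <= 1 - x * be -> kernel x <= expR ((1 - `|x|) / 2).
Proof.
move=> *; apply: (le_trans (kernel_le _ _ _ _)) => //.
have x0 := normr_ge0 x.
rewrite ler_expR -subr_ge0.
have -> : (1 - `|x|) / 2 - - (x ^+ 2 / (2 * (1 + `|x|))) =
    (1 - `|x| ^+ 2 + x ^+ 2) / (2 * (1 + `|x|)) by field; lra.
by rewrite real_normK ?num_real// subrK divr_ge0//; lra.
Qed.

(** Both logarithms have arguments where [ln1D_ge] applies, which leaves exp(- x^2). This lower
    bound is what controls the constant [binK]. *)
Lemma kernel_ge x : al <= 2^-1 -> be <= 2^-1 -> `|x| <= 1 -> expR (-1) <= kernel x.
Proof.
move=> al2 be2 x1; have /andP[x2 x3] : -1 <= x <= 1 by rewrite -ler_norml.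
have [h1 h2] : - 2^-1 <= x * al /\ - 2^-1 <= - (x * be).
  by case/andP: al01 => ? _; case/andP: be01 => ? _; split; nra.
rewrite kernelE; [|lra|lra].
rewrite ler_expR; have k1 := ln1D_ge h1; have k2 := ln1D_ge h2.
have {}k1 : a%:R * (x * al - (x * al) ^+ 2) <= a%:R * ln (1 + x * al) by rewrite ler_wpM2l.
have {}k2 : b%:R * (- (x * be) - (- (x * be)) ^+ 2) <= b%:R * ln (1 + - (x * be)) by rewrite ler_wpM2l.
apply: le_trans (lerD k1 k2).
have -> : a%:R * (x * al - (x * al) ^+ 2) + b%:R * (- (x * be) - (- (x * be)) ^+ 2) =
  x * (a%:R * al - b%:R * be) - x ^+ 2 * (a%:R * al ^+ 2 + b%:R * be ^+ 2) by ring.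
by rewrite first_order second_order subrr mulr0 mulr1 add0r lerN2; nra.
Qed.

(** The cubic remainders add up to 2 |x|^3 (a al^3 + b be^3), and [second_order] makes a al^2 and b
    be^2 at most 1. *)
Lemma ln_kernel_bound x : `|x| * al <= 2^-1 -> `|x| * be <= 2^-1 ->
  `|a%:R * ln (1 + x * al) + b%:R * ln (1 + - (x * be)) + x ^+ 2 / 2| <=
  2 * `|x| ^+ 3 * (al + be).
Proof.
move=> xal xbe; have /andP[al0 _] := al01; have /andP[be0 _] := be01.
have e1 : `|x * al| = `|x| * al by rewrite normrM (ger0_norm al0).
have e2 : `|- (x * be)| = `|x| * be by rewrite normrN normrM (ger0_norm be0).
have k1 := @ln1D_sub_quad_bound R (x * al); have k2 := @ln1D_sub_quad_bound R (- (x * be)).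
rewrite e1 in k1; rewrite e2 in k2; move: (k1 xal) (k2 xbe) => {}k1 {}k2.
have -> : a%:R * ln (1 + x * al) + b%:R * ln (1 + - (x * be)) + x ^+ 2 / 2 =
  a%:R * (ln (1 + x * al) - x * al + (x * al) ^+ 2 / 2) +
  b%:R * (ln (1 + - (x * be)) - - (x * be) + (- (x * be)) ^+ 2 / 2).
  have -> : x ^+ 2 / 2 = x ^+ 2 * (a%:R * al ^+ 2 + b%:R * be ^+ 2) / 2 +
      x * (b%:R * be - a%:R * al) by rewrite first_order second_order; ring.
  ring.
apply: (le_trans (ler_normD _ _)).
have -> : 2 * `|x| ^+ 3 * (al + be) = 2 * `|x| ^+ 3 * al + 2 * `|x| ^+ 3 * be by ring.
have q1 : 0 <= a%:R * al ^+ 2 by rewrite mulr_ge0 ?sqr_ge0.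
have q2 : 0 <= b%:R * be ^+ 2 by rewrite mulr_ge0 ?sqr_ge0.
have c1 : a%:R * al ^+ 2 <= 1 by move: second_order q2; lra.
have c2 : b%:R * be ^+ 2 <= 1 by move: second_order q1; lra.
apply: lerD; rewrite normrM ger0_norm//.
- apply: (le_trans (ler_wpM2l _ k1)) => //.
  have -> : a%:R * (2 * (`|x| * al) ^+ 3) = (a%:R * al ^+ 2) * (2 * `|x| ^+ 3 * al) by ring.
  by rewrite ler_piMl// mulr_ge0// mulr_ge0// exprn_ge0.
- apply: (le_trans (ler_wpM2l _ k2)) => //.
  have -> : b%:R * (2 * (`|x| * be) ^+ 3) = (b%:R * be ^+ 2) * (2 * `|x| ^+ 3 * be) by ring.
  by rewrite ler_piMl// mulr_ge0// mulr_ge0// exprn_ge0.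
Qed.

End kernel_bounds.

(** * Binomial tails as integrals of the kernel *)

Section binomial_kernel.
Context {R : realType}.

(* With [a] successes and [b] failures, [mode a b] is the maximiser of
   [s ^ a (1 - s) ^ b] and [scale a b] its width. *)
Definition spread (a b : nat) : R := Num.sqrt (a%:R * b%:R / (a + b)%:R).
Definition mode (a b : nat) : R := a%:R / (a + b)%:R.
Definition scale (a b : nat) : R := spread a b / (a + b)%:R.
Definition bkernel (a b : nat) : R -> R :=
  kernel a b (spread a b / a%:R) (spread a b / b%:R).
(** For n = a + b + 1 uniform variables, the distribution function of the order statistic of rank a
    + 1, in coordinates centred at the mode. Differentiation uses up one trial, which leaves [a]
    successes and [b] failures. *)
Definition binG (a b : nat) (x : R) : R :=
  binE (mode a b + scale a b * x) (a + b).+1 (tail_ind a.+1).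
(** The slope of [binG] at 0: the kernel is 1 there. *)
Definition binK (a b : nat) : R := scale a b * (a + b).+1%:R *
  ('C(a + b, a)%:R * mode a b ^+ a * (1 - mode a b) ^+ b).

Variables (a b : nat).
Hypotheses (a0 : (0 < a)%N) (b0 : (0 < b)%N).

Let A0 : 0 < a%:R :> R. Proof. by rewrite ltr0n. Qed.
Let B0 : 0 < b%:R :> R. Proof. by rewrite ltr0n. Qed.
Let A1 : 1 <= a%:R :> R. Proof. by rewrite ler1n. Qed.
Let B1 : 1 <= b%:R :> R. Proof. by rewrite ler1n. Qed.

Lemma sqr_spread : spread a b ^+ 2 = a%:R * b%:R / (a%:R + b%:R).
Proof. by rewrite sqr_sqrtr ?natrD// divr_ge0 ?mulr_ge0// ?addr_ge0. Qed.

Lemma spread_gt0 : 0 < spread a b.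
Proof. by rewrite sqrtr_gt0 divr_gt0 ?mulr_gt0// ltr0n addn_gt0 a0. Qed.

Let sa01 : 0 <= spread a b / a%:R <= 1.
Proof.
rewrite divr_ge0 ?(ltW spread_gt0)//= ler_pdivrMr// mul1r.
rewrite -(@ler_sqr R) ?nnegrE ?(ltW spread_gt0)// sqr_spread ler_pdivrMr ?addr_gt0//.
have : 0 <= (a%:R * a%:R + (a%:R - 1) * b%:R) * a%:R :> R.
  by rewrite mulr_ge0 ?addr_ge0 ?mulr_ge0 ?subr_ge0.
lra.
Qed.

Let sb01 : 0 <= spread a b / b%:R <= 1.
Proof.
rewrite divr_ge0 ?(ltW spread_gt0)//= ler_pdivrMr// mul1r.
rewrite -(@ler_sqr R) ?nnegrE ?(ltW spread_gt0)// sqr_spread ler_pdivrMr ?addr_gt0//.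
have : 0 <= (b%:R * b%:R + a%:R * (b%:R - 1)) * b%:R :> R.
  by rewrite mulr_ge0 ?addr_ge0 ?mulr_ge0 ?subr_ge0.
lra.
Qed.

Let ord1 : a%:R * (spread a b / a%:R) = b%:R * (spread a b / b%:R).
Proof. by field; rewrite !gt_eqF. Qed.

Let ord2 : a%:R * (spread a b / a%:R) ^+ 2 + b%:R * (spread a b / b%:R) ^+ 2 = 1.
Proof.
rewrite !exprMn sqr_spread; field.
by rewrite !gt_eqF// addr_gt0.
Qed.

Lemma mode_scaleE (x : R) :
  mode a b + scale a b * x = mode a b * (1 + x * (spread a b / a%:R)).
Proof.
rewrite /mode /scale natrD; field.
by rewrite !gt_eqF// addr_gt0.
Qed.

Lemma mode_scaleC (x : R) :
  1 - (mode a b + scale a b * x) = (1 - mode a b) * (1 - x * (spread a b / b%:R)).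
Proof.
rewrite /mode /scale natrD; field.
by rewrite !gt_eqF// addr_gt0.
Qed.

Lemma mode_gt0 : 0 < mode a b.
Proof. by rewrite divr_gt0// ltr0n addn_gt0 a0. Qed.

Lemma mode_lt1 : mode a b < 1.
Proof. by rewrite ltr_pdivrMr ?mul1r ?ltr0n ?addn_gt0 ?a0// natrD ltrDl. Qed.

Lemma scale_gt0 : 0 < scale a b.
Proof. by rewrite divr_gt0 ?spread_gt0// ltr0n addn_gt0 a0. Qed.

Lemma binE_kernel x : binE (mode a b + scale a b * x) (a + b) (fun m => (m == a)%:R) =
  'C(a + b, a)%:R * mode a b ^+ a * (1 - mode a b) ^+ b * bkernel a b x.
Proof.
rewrite binE_eq mode_scaleC mode_scaleE !exprMn addKn /bkernel /kernel; ring.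
Qed.

Lemma is_derive_binG (x : R) : is_derive x 1 (binG a b) (binK a b * bkernel a b x).
Proof.
have e1 := is_deriveD (is_derive_cst (mode a b) x (1 : R))
  (is_deriveM (is_derive_cst (scale a b) x (1 : R)) (is_derive_id x (1 : R))).
have e := is_derive1_comp (is_derive_binE (a + b).+1 (tail_ind a.+1) _) e1.
apply: (is_derive_eq e).
(* The increment of [tail_ind a.+1] is the indicator of [m = a]. *)
rewrite (_ : binE _ _ _ = binE (mode a b + scale a b * x) (a + b) (fun m => (m == a)%:R)).
  by rewrite binE_kernel /GRing.scale/= /binK; ring.
apply: eq_binE => m _; rewrite /tail_ind ltnS.
by case: ltngtP => _; rewrite ?subrr ?subr0.
Qed.

Lemma kernel_domain (x : R) : 0 <= mode a b + scale a b * x <= 1 ->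
  0 <= 1 + x * (spread a b / a%:R) /\ 0 <= 1 - x * (spread a b / b%:R).
Proof.
move=> /andP[h1 h2]; split.
  by move: h1; rewrite mode_scaleE pmulr_rge0// mode_gt0.
by move: h2; rewrite -subr_ge0 mode_scaleC pmulr_rge0// subr_gt0 mode_lt1.
Qed.

Lemma bkernel_ge0 x : 0 <= mode a b + scale a b * x <= 1 -> 0 <= bkernel a b x.
Proof. by move=> /kernel_domain[h1 h2]; rewrite mulr_ge0// exprn_ge0. Qed.

Lemma bkernel_le1 x : 0 <= mode a b + scale a b * x <= 1 -> bkernel a b x <= 1.
Proof. by move=> /kernel_domain[h1 h2]; apply: kernel_le1. Qed.

Lemma bkernel_le_exp x : 0 <= mode a b + scale a b * x <= 1 ->
  bkernel a b x <= expR ((1 - `|x|) / 2).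
Proof. by move=> /kernel_domain[h1 h2]; apply: kernel_le_exp. Qed.

Lemma binK_gt0 : 0 < binK a b :> R.
Proof.
apply: mulr_gt0; first by rewrite mulr_gt0 ?scale_gt0// ltr0n.
apply: mulr_gt0; last by rewrite exprn_gt0// subr_gt0 mode_lt1.
apply: mulr_gt0; last by rewrite exprn_gt0// mode_gt0.
by rewrite ltr0n bin_gt0 leq_addr.
Qed.

Lemma bkernel_near (x : R) : `|x| * (spread a b / a%:R) <= 2^-1 ->
  `|x| * (spread a b / b%:R) <= 2^-1 ->
  exists2 u, bkernel a b x = expR u &
    `|u + x ^+ 2 / 2| <= 2 * `|x| ^+ 3 * (spread a b / a%:R + spread a b / b%:R).
Proof.
move=> h1 h2; have k := ln_kernel_bound sa01 sb01 ord1 ord2 h1 h2.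
exists (a%:R * ln (1 + x * (spread a b / a%:R)) +
        b%:R * ln (1 + - (x * (spread a b / b%:R)))) => //.
have s0 := ltW spread_gt0.
rewrite /bkernel kernelE//.
- have : `|x * (spread a b / a%:R)| <= 2^-1.
    by rewrite normrM (ger0_norm (divr_ge0 s0 (ltW A0))).
  by rewrite ler_norml; lra.
- have : `|x * (spread a b / b%:R)| <= 2^-1.
    by rewrite normrM (ger0_norm (divr_ge0 s0 (ltW B0))).
  by rewrite ler_norml; lra.
Qed.

Lemma spread_le_sqrtl : spread a b / a%:R <= Num.sqrt (a%:R^-1) :> R.
Proof.
rewrite ler_pdivrMr// -{2}(@sqr_sqrtr R a%:R)// expr2 mulrA -sqrtrM ?invr_ge0//.
rewrite mulVf ?gt_eqF// sqrtr1 mul1r ler_wsqrtr// natrD ler_pdivrMr ?addr_gt0//.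
by rewrite ler_wpM2l// lerDr.
Qed.

Lemma spread_le_sqrtr : spread a b / b%:R <= Num.sqrt (b%:R^-1) :> R.
Proof.
rewrite ler_pdivrMr// -{2}(@sqr_sqrtr R b%:R)// expr2 mulrA -sqrtrM ?invr_ge0//.
rewrite mulVf ?gt_eqF// sqrtr1 mul1r ler_wsqrtr// natrD ler_pdivrMr ?addr_gt0//.
by rewrite mulrC ler_wpM2l// lerDl.
Qed.

End binomial_kernel.

(** * Uniform bounds on binomial probabilities *)

Section binomial_concentration.
Context {R : realType}.
Variables (a b : nat).
Hypotheses (a4 : (4 <= a)%N) (b4 : (4 <= b)%N).

Let a0 : (0 < a)%N. Proof. exact: leq_trans a4. Qed.
Let b0 : (0 < b)%N. Proof. exact: leq_trans b4. Qed.
Let A4 : @Order.le _ R 4 a%:R. Proof. by rewrite ler_nat. Qed.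
Let B4 : @Order.le _ R 4 b%:R. Proof. by rewrite ler_nat. Qed.

(** The square is b / (a (a + b)) <= 1 / a, so the threshold 4 produces the 1/2 required by
    [kernel_ge]. *)
Let sa2 : spread a b / a%:R <= 2^-1 :> R.
Proof.
rewrite ler_pdivrMr; last by move: A4 B4; lra.
have h0 := ltW (@spread_gt0 R _ _ a0 b0).
have h1 : 0 <= 2^-1 * a%:R :> R by rewrite mulr_ge0.
rewrite -(ler_sqr (h0 : _ \is Num.nneg) (h1 : _ \is Num.nneg)).
rewrite sqr_spread// ler_pdivrMr; last by move: A4 B4; lra.
have : 0 <= (a%:R * a%:R + (a%:R - 4) * b%:R) * a%:R :> R.
  by rewrite mulr_ge0 ?addr_ge0 ?mulr_ge0 ?subr_ge0.
lra.
Qed.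

Let sb2 : spread a b / b%:R <= 2^-1 :> R.
Proof.
rewrite ler_pdivrMr; last by move: A4 B4; lra.
have h0 := ltW (@spread_gt0 R _ _ a0 b0).
have h1 : 0 <= 2^-1 * b%:R :> R by rewrite mulr_ge0.
rewrite -(ler_sqr (h0 : _ \is Num.nneg) (h1 : _ \is Num.nneg)).
rewrite sqr_spread// ler_pdivrMr; last by move: A4 B4; lra.
have : 0 <= (b%:R * b%:R + a%:R * (b%:R - 4)) * b%:R :> R.
  by rewrite mulr_ge0 ?addr_ge0 ?mulr_ge0 ?subr_ge0.
lra.
Qed.

Let unit_domain (x : R) : 0 <= x <= 1 -> 0 <= mode a b + scale a b * x <= 1.
Proof.
move=> /andP[x0 x1]; apply/andP; split.
  have sc : 0 <= scale a b :> R by rewrite ltW// scale_gt0.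
  by apply: addr_ge0; [exact/ltW/mode_gt0|exact: mulr_ge0].
rewrite -subr_ge0 mode_scaleC// mulr_ge0 ?subr_ge0 ?(ltW (mode_lt1 _ _))//.
by have := sb2; have : 0 <= spread a b / b%:R :> R; [rewrite divr_ge0 ?(ltW (spread_gt0 _ _))|nra].
Qed.

(** [binG] grows by at most 1 on [0, 1], being a probability, while by the mean value theorem the
    growth is [binK] times a kernel value that is at least 1/e. *)
Lemma binK_le : binK a b <= expR 1 :> R.
Proof.
have [||c] := @MVT R (binG a b) (fun x => binK a b * bkernel a b x) 0 1 ltr01.
- by move=> x _; exact: is_derive_binG.
- apply: (@derivable_within_continuous_itv _ _ (fun x => binK a b * bkernel a b x)) => t _.
  exact: is_derive_binG.
rewrite in_itv/= subr0 mulr1 => /andP[c0 c1] h.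
have k1 : expR (-1) <= bkernel a b c.
  apply: kernel_ge => //.
  - by rewrite divr_ge0 ?(ltW (spread_gt0 _ _))//=; move: sa2; lra.
  - by rewrite divr_ge0 ?(ltW (spread_gt0 _ _))//=; move: sb2; lra.
  - by field; rewrite !pnatr_eq0 -!lt0n a0 b0.
  - by rewrite !exprMn sqr_spread//; field; rewrite !pnatr_eq0 -!lt0n a0 b0 gt_eqF//; move: A4 B4; lra.
  - by rewrite ger0_norm; lra.
have : binG a b 1 - binG a b 0 <= 1 :> R.
  rewrite lerBlDr (le_trans (_ : _ <= 1))//.
    by apply: binE_le1 => [|m]; [apply: unit_domain; lra|exact: tail_ind_le1].
  rewrite lerDl; apply: binE_ge0 => [|m]; [apply: unit_domain; lra|exact: tail_ind_ge0].
rewrite h => h1.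
rewrite -[leRHS]mul1r -ler_pdivrMr ?expR_gt0// -expRN.
by apply: le_trans h1; rewrite ler_wpM2l//; exact/ltW/binK_gt0.
Qed.

(** The kernel is at most 1, so the probability is largest at the mode; there it equals [binK]
    divided by scale (a + b + 1), which exceeds scale (a + b), the spread. *)
Lemma binE_eq_le (s : R) : 0 <= s <= 1 ->
  binE s (a + b) (fun m => (m == a)%:R) <= expR 1 / spread a b.
Proof.
move=> s01; have t0 : 0 < scale a b :> R by exact: scale_gt0.
have N0 : 0 < (a + b)%:R :> R by rewrite ltr0n addn_gt0 a0.
pose x := (s - mode a b) / scale a b.
have sx : s = mode a b + scale a b * x by rewrite /x; field; rewrite gt_eqF.
have hx : bkernel a b x <= 1 by apply: bkernel_le1 => //; rewrite -sx.
have hx0 : 0 <= bkernel a b x by apply: bkernel_ge0 => //; rewrite -sx.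
rewrite sx binE_kernel//.
rewrite ler_pdivlMr ?spread_gt0//; apply: le_trans binK_le.
have sE : spread a b = scale a b * (a + b)%:R :> R by rewrite /scale divfK// gt_eqF.
rewrite [leLHS]mulrC sE /binK; set c := _ * _ * (1 - _) ^+ b.
have c0 : 0 <= c.
  rewrite /c mulr_ge0 ?mulr_ge0 ?exprn_ge0 ?(ltW (mode_gt0 _ _))//.
  by rewrite subr_ge0 ltW// mode_lt1.
rewrite ler_pM//.
- by rewrite mulr_ge0// ltW.
- by rewrite mulr_ge0.
- by rewrite ler_pM2l// ler_nat.
- by rewrite ler_piMr.
Qed.

End binomial_concentration.

Lemma window_le_sum {R : realType} (r w m : nat) :
  window r w m <= \sum_(l < w) (m == (r - l.+1)%N)%:R :> R.
Proof.
rewrite /window; case: andP => [[rw mr]|_]; last by apply: sumr_ge0.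
have lw : (r - m.+1 < w)%N by lia.
rewrite (bigD1 (Ordinal lw))//= (_ : m == _); last by apply/eqP; lia.
by rewrite lerDl sumr_ge0.
Qed.

(** The window consists of the values a - l with l < w. As [w.*2 <= A], they stay at least A/2 away
    from 0 and from the number of trials, where the spread is at least half the root of [A];
    [8 <= A] secures the threshold 4. *)
Lemma binE_window_le {R : realType} (a b w A : nat) (s : R) :
  (8 <= A)%N -> (A <= a)%N -> (A <= b)%N -> (w.*2 <= A)%N -> 0 <= s <= 1 ->
  binE s (a + b).+1 (window a.+1 w) <= 2 * expR 1 * (w%:R / Num.sqrt A%:R).
Proof.
move=> A8 Aa Ab wA s01.
have A0 : 0 < A%:R :> R by rewrite ltr0n; lia.
have sA0 : 0 < Num.sqrt A%:R :> R by rewrite sqrtr_gt0.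
have e0 : 0 <= expR 1 :> R by exact: expR_ge0.
have pmf l : (l < w)%N ->
    binE s (a + b).+1 (fun m => (m == (a.+1 - l.+1)%N)%:R) <= 2 * expR 1 / Num.sqrt A%:R.
  move=> lw; rewrite subSS; set i := (a - l)%N; have ia : i = (a - l)%N by [].
  have -> : (a + b).+1 = (i + ((a + b).+1 - i))%N by lia.
  set j := ((a + b).+1 - i)%N.
  have [i4 j4] : (4 <= i)%N /\ (4 <= j)%N by rewrite /j; lia.
  apply: (le_trans (binE_eq_le i4 j4 s01)).
  have [i0 j0] : (0 < i)%N /\ (0 < j)%N by lia.
  have sp := @spread_gt0 R _ _ i0 j0.
  rewrite ler_pdivrMr// mulrAC ler_pdivlMr// mulrAC [leRHS]mulrC ler_wpM2l//.
  have h : Num.sqrt A%:R <= 2 * spread i j :> R.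
    have P : 0 <= 2 * spread i j :> R by rewrite mulr_ge0// ltW.
    rewrite -(ler_sqr (ltW sA0 : _ \is Num.nneg) (P : _ \is Num.nneg)).
    rewrite sqr_sqrtr ?(ltW A0)// exprMn sqr_spread//.
    have [ri rj] : A%:R <= 2 * i%:R :> R /\ A%:R <= 2 * j%:R :> R.
      by rewrite -!natrM !ler_nat /j; lia.
    have I0 : 0 < i%:R :> R by rewrite ltr0n.
    have J0 : 0 < j%:R :> R by rewrite ltr0n.
    rewrite mulrA ler_pdivlMr ?addr_gt0//; nra.
  exact: h.
apply: (le_trans (binE_le _ s01 (fun m => window_le_sum _ _ m))).
rewrite binE_sum; apply: (le_trans (ler_sum _ (fun l _ => pmf _ (ltn_ord l)))).
rewrite sumr_const card_ord le_eqVlt; apply/orP; left; apply/eqP.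
by rewrite -[LHS]mulr_natr; ring.
Qed.

(** * Limits of real sequences *)

Section real_sequences.
Context {R : realType}.
Implicit Types (f g : nat -> R) (l : R).

Lemma cvg_near_eq (U : topologicalType) (f g : nat -> U) (l : U) : (\forall n \near \oo, f n = g n) ->
  f n @[n --> \oo] --> l -> g n @[n --> \oo] --> l.
Proof. by move=> fg fl; apply: cvg_trans fl; exact: near_eq_cvg. Qed.

Lemma cvg_inv_pinfty f : f n @[n --> \oo] --> +oo -> (f n)^-1 @[n --> \oo] --> (0 : R).
Proof.
move=> fy; apply/gtr0_cvgV0; last first.
  exact: fy.
have /cvgryPge/(_ 1) := fy; apply: filterS => n fn.
by rewrite (lt_le_trans _ fn).
Qed.

Lemma cvg_invn (k : nat -> nat) : k n @[n --> \oo] --> \oo ->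
  ((k n)%:R^-1 : R) @[n --> \oo] --> (0 : R).
Proof. by move=> koo; apply: cvg_inv_pinfty; exact/cvgrnyP. Qed.

Lemma near_leq (k : nat -> nat) m : k n @[n --> \oo] --> \oo ->
  \forall n \near \oo, (m <= k n)%N.
Proof. by move=> koo; exact: (koo _ (nbhs_infty_ge m)). Qed.

Lemma near_posn : \forall n \near \oo, (0 < n)%N.
Proof. exact: nbhs_infty_ge. Qed.

Lemma cvg_sqrt f l : f n @[n --> \oo] --> l ->
  Num.sqrt (f n) @[n --> \oo] --> Num.sqrt l.
Proof. by move=> fl; apply: continuous_cvg => //; exact: sqrt_continuous. Qed.

Lemma cvg_expR f l : f n @[n --> \oo] --> l -> expR (f n) @[n --> \oo] --> expR l.
Proof. by move=> fl; apply: continuous_cvg => //; exact: continuous_expR. Qed.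

Lemma cvg_dist0 f g l : (\forall n \near \oo, `|f n - l| <= g n) ->
  g n @[n --> \oo] --> 0 -> f n @[n --> \oo] --> l.
Proof.
move=> fg g0; apply/cvgrPdist_le => e e0.
have /cvgrPdist_le/(_ e e0) := g0.
apply: filterS2 fg => n fn; rewrite sub0r normrN => gn.
by rewrite distrC (le_trans fn)// (le_trans _ gn)// ler_norm.
Qed.

Lemma near_cvg0_le f (e : R) : f n @[n --> \oo] --> (0 : R) -> 0 < e ->
  \forall n \near \oo, f n <= e.
Proof.
move=> /cvgrPdist_le/[apply]; apply: filterS => n.
by rewrite sub0r normrN; apply: le_trans; exact: ler_norm.
Qed.

Lemma squeeze0 f g : (\forall n \near \oo, 0 <= f n <= g n) ->
  g n @[n --> \oo] --> 0 -> f n @[n --> \oo] --> 0.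
Proof.
move=> fg; apply: cvg_dist0; apply: filterS fg => n /andP[f0 fn].
by rewrite subr0 ger0_norm.
Qed.

End real_sequences.

(** * The Poisson limit *)

Section poisson_limit.
Context {R : realType}.
Variable lam : R.
Hypothesis lam0 : 0 <= lam.

Let ratio_cvg0 : lam / n%:R @[n --> \oo] --> (0 : R).
Proof.
rewrite -(mulr0 lam); apply: cvgMl_tmp; apply: cvg_invn.
by apply/(@cvgrnyP R); exact: cvgr_idn.
Qed.

Let ratio_small : \forall n \near \oo, lam / n%:R <= 2^-1 :> R.
Proof.
by apply: near_cvg0_le; [exact: ratio_cvg0|rewrite invr_gt0].
Qed.

(** n ln(1 - lam / n) lies between - lam - lam^2 / n and - lam. *)
Lemma cvg_one_sub_div_expn : (1 - lam / n%:R) ^+ n @[n --> \oo] --> expR (- lam).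
Proof.
apply: (@cvg_near_eq _ (fun n => expR (n%:R * ln (1 + - (lam / n%:R))))).
  near=> n; rewrite -expr_expR//.
  have : lam / n%:R <= 2^-1 by near: n; exact: ratio_small.
  lra.
apply: cvg_expR.
apply: (@cvg_dist0 _ _ (fun n : nat => lam * (lam / n%:R))); last first.
  by rewrite -(mulr0 lam); apply: cvgMl_tmp; exact: ratio_cvg0.
near=> n.
have n0 : 0 < n%:R :> R by rewrite ltr0n; near: n; exact: near_posn.
have r2 : lam / n%:R <= 2^-1 by near: n; exact: ratio_small.
have r0 : 0 <= lam / n%:R by rewrite divr_ge0// ltW.
have h1 : - 2^-1 <= - (lam / n%:R) by rewrite lerN2.
have h2 := ln1D_ge h1.
have h3 : ln (1 + - (lam / n%:R)) <= - (lam / n%:R) by apply: le_ln1Dx; lra.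
have {}h2 := ler_wpM2l (ltW n0) h2; have {}h3 := ler_wpM2l (ltW n0) h3.
have e1 : n%:R * - (lam / n%:R) = - lam by field; rewrite gt_eqF.
have e2 : n%:R * (- (lam / n%:R) - (- (lam / n%:R)) ^+ 2) = - lam - lam * (lam / n%:R).
  by field; rewrite gt_eqF.
rewrite e1 in h3; rewrite e2 in h2.
by rewrite ler_norml; apply/andP; split; [lra|have : 0 <= lam * (lam / n%:R); [exact: mulr_ge0|lra]].
Unshelve. all: by end_near. Qed.

(** Induction on [i] through the ratio of consecutive probabilities, (n - i) p / ((i + 1) (1 - p))
    with p = lam / n, which tends to lam / (i + 1). *)
Lemma cvg_binomial_pmf i :
  'C(n, i)%:R * (lam / n%:R) ^+ i * (1 - lam / n%:R) ^+ (n - i) @[n --> \oo] -->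
  expR (- lam) * (lam ^+ i / i`!%:R).
Proof.
elim: i => [|i IH].
  rewrite fact0 invr1 !mulr1.
  apply: cvg_near_eq cvg_one_sub_div_expn.
  by apply: nearW => n; rewrite bin0 expr0 subn0 !mul1r.
have -> : expR (- lam) * (lam ^+ i.+1 / (i.+1)`!%:R) =
    expR (- lam) * (lam ^+ i / i`!%:R) * (i.+1%:R^-1 * (lam * (1 - i%:R * 0)) * (1 - 0)^-1).
  rewrite subr0 mulr0 subr0 invr1 !mulr1 factS natrM exprS; field.
  by rewrite nat1r !pnatr_eq0/= -lt0n; exact: fact_gt0.
have inv0 : ((n%:R)^-1 : R) @[n --> \oo] --> (0 : R).
  by apply: cvg_invn; apply/(@cvgrnyP R); exact: cvgr_idn.
apply: (@cvg_near_eq _ (fun n : nat =>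
   'C(n, i)%:R * (lam / n%:R) ^+ i * (1 - lam / n%:R) ^+ (n - i) *
   (i.+1%:R^-1 * (lam * (1 - i%:R * n%:R^-1)) * (1 - lam / n%:R)^-1))).
  near=> n.
  have n0 : n%:R != 0 :> R by rewrite pnatr_eq0 -lt0n; near: n; exact: near_posn.
  have ni : (i < n)%N by near: n; exact: nbhs_infty_gt.
  have r2 : lam / n%:R <= 2^-1 by near: n; exact: ratio_small.
  have -> : (n - i = (n - i.+1).+1)%N by lia.
  have hC : i.+1%:R * 'C(n, i.+1)%:R = (n%:R - i%:R) * 'C(n, i)%:R :> R.
    by rewrite -natrB ?(ltnW ni)// -!natrM mul_bin_left.
  have -> : 'C(n, i.+1)%:R = (n%:R - i%:R) * 'C(n, i)%:R / i.+1%:R :> R.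
    by rewrite -hC mulrAC divff ?mul1r// pnatr_eq0.
  rewrite !exprS; field.
  have hd : n%:R - lam != 0.
    move: r2; rewrite ler_pdivrMr ?lt0r ?n0//= => r2.
    by have : 0 < n%:R :> R; [rewrite lt0r n0 /=|lra].
  by rewrite n0 hd nat1r pnatr_eq0.
apply: cvgM => //; apply: cvgM; [apply: cvgMl_tmp; apply: cvgMl_tmp|].
  by apply: cvgB; [exact: cvg_cst|apply: cvgMl_tmp].
apply: cvgV; first by rewrite subr0 oner_eq0.
by apply: cvgB; [exact: cvg_cst|exact: ratio_cvg0].
Unshelve. all: by end_near. Qed.

(** At least n - j + 1 successes means fewer than [j] failures, and a failure has probability lam /
    n. *)
Lemma poisson_limit j :
  binE (1 - lam / n%:R) n (tail_ind (n - j + 1)) @[n --> \oo] -->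
  expR (- lam) * \sum_(0 <= i < j) lam ^+ i / i`!%:R.
Proof.
apply: (@cvg_near_eq _ (fun n : nat => \sum_(0 <= i < j)
   ('C(n, i)%:R * (lam / n%:R) ^+ i * (1 - lam / n%:R) ^+ (n - i)))).
  near=> n.
  have jn : (j <= n)%N by near: n; exact: nbhs_infty_ge.
  rewrite [RHS]binE_reflect subKr.
  transitivity (binE (lam / n%:R) n (fun m => \sum_(0 <= i < j) (m == i)%:R)).
    by rewrite binE_sum; apply: eq_bigr => i _; rewrite binE_eq.
  apply: eq_binE => m mn; rewrite /tail_ind big_mkord.
  case: leqP => h.
    have mj : (m < j)%N by lia.
    rewrite (bigD1 (Ordinal mj))//= eqxx big1 ?addr0// => i im.
    by case: eqP => // mi; move: im; rewrite -val_eqE/= mi eqxx.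
  rewrite big1// => i _; case: eqP => // mi.
  by have := ltn_ord i; lia.
rewrite mulr_sumr; elim: j => [|j IH].
  rewrite big_nil; apply: cvg_near_eq (cvg_cst _).
  by apply: nearW => n; rewrite big_nil.
rewrite big_nat_recr//=.
apply: (@cvg_near_eq _ (fun n : nat => \sum_(0 <= i < j)
   ('C(n, i)%:R * (lam / n%:R) ^+ i * (1 - lam / n%:R) ^+ (n - i)) +
   'C(n, j)%:R * (lam / n%:R) ^+ j * (1 - lam / n%:R) ^+ (n - j))).
  by apply: nearW => n; rewrite big_nat_recr.
by apply: cvgD => //; exact: cvg_binomial_pmf.
Unshelve. all: by end_near. Qed.

End poisson_limit.

(** * The kernel as a dominated family of integrands *)

Section truncated_kernel.
Context {R : realType}.
Notation mu := (@lebesgue_measure R).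

Lemma normal_pdf01E (z : R) : normal_pdf 0 1 z = normal_peak 1 * expR (- (z ^+ 2 / 2)).
Proof.
rewrite normal_pdfE ?oner_eq0// /normal_fun subr0 expr1n; congr (_ * expR _).
by rewrite mulNr mulr2n.
Qed.

(** All validity conditions sit inside the set, so that measurability and the majorant hold for
    every index, as dominated convergence asks, and not just eventually. *)
Definition kernel_domain_set (a b : nat) (y : R) : set R :=
  [set z | [&& (0 < a)%N, (0 < b)%N, 0 <= mode a b + scale a b * z,
     z <= y & mode a b + scale a b * y <= 1]].

Definition trunc_kernel (a b : nat) (y : R) : R -> \bar R :=
  (fun z => (normal_peak 1 * bkernel a b z)%:E) \_ (kernel_domain_set a b y).

Lemma kernel_domain_setE a b y : (0 < a)%N -> (0 < b)%N ->
  mode a b + scale a b * y <= 1 ->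
  kernel_domain_set a b y = [set` `[- (mode a b / scale a b), y]].
Proof.
move=> a0 b0 hy; have s0 : 0 < scale a b :> R by exact: scale_gt0.
apply/seteqP; split => z; rewrite /kernel_domain_set /= a0 b0 hy andbT/= in_itv/=.
  by move=> /andP[h ->]; rewrite andbT -mulNr ler_pdivrMr// mulrC; lra.
by move=> /andP[h ->]; rewrite andbT; move: h; rewrite -mulNr ler_pdivrMr// mulrC; lra.
Qed.

Lemma measurable_kernel_domain_set a b y : measurable (kernel_domain_set a b y).
Proof.
have [/and3P[a0 b0 hy]|h] :=
  boolP [&& (0 < a)%N, (0 < b)%N & mode a b + scale a b * y <= 1].
  by rewrite kernel_domain_setE.
rewrite (_ : kernel_domain_set _ _ _ = set0)//.
by apply/seteqP; split => // z /= /and5P[a0 b0 _ _ hy]; move: h; rewrite a0 b0 hy.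
Qed.

Lemma continuous_bkernel a b : continuous (@bkernel R a b).
Proof.
move=> z; rewrite /bkernel /kernel.
apply: cvgM; apply: (@continuous_cvg _ _ _ _ _ _ (fun y : R => y ^+ _));
  try exact: exprn_continuous.
  by apply: cvgD; [exact: cvg_cst|apply: cvgMr_tmp].
by apply: cvgB; [exact: cvg_cst|apply: cvgMr_tmp].
Qed.

Lemma measurable_trunc_kernel a b y : measurable_fun setT (trunc_kernel a b y).
Proof.
apply/(measurable_restrictT _ (measurable_kernel_domain_set a b y)).
apply: measurable_funTS; apply/measurable_EFinP.
apply: continuous_measurable_fun => z.
by apply: cvgMl_tmp; exact: continuous_bkernel.
Qed.

(** [binG] vanishes at the left end, where the success probability is 0. The factor in front of
    [binG] is the same for all [y], so quotients of such integrals do not see it. *)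
Lemma integral_trunc_kernel a b y : (0 < a)%N -> (0 < b)%N ->
  0 < mode a b + scale a b * y <= 1 ->
  (\int[mu]_z trunc_kernel a b y z = (normal_peak 1 / binK a b * binG a b y)%:E)%E.
Proof.
move=> a0 b0 /andP[hy0 hy1]; have s0 : 0 < scale a b :> R by exact: scale_gt0.
have K0 : 0 < binK a b :> R by exact: binK_gt0.
rewrite /trunc_kernel -integral_mkcond kernel_domain_setE//.
set lo := - (mode a b / scale a b).
have loy : lo < y by rewrite /lo -mulNr ltr_pdivrMr// mulrC; lra.
have dF (z : R) : is_derive z 1 (fun z => normal_peak 1 / binK a b * binG a b z)
    (normal_peak 1 * bkernel a b z).
  have e := is_deriveM (is_derive_cst (normal_peak 1 / binK a b) z (1 : R))
    (is_derive_binG a0 b0 z).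
  apply: (is_derive_eq e); rewrite /GRing.scale/=; field.
  by rewrite gt_eqF.
have cF : continuous (fun z : R => normal_peak 1 / binK a b * binG a b z).
  move=> z; apply: differentiable_continuous; apply/derivable1_diffP.
  by have [] := dF z.
rewrite (@continuous_FTC2 _ _ (fun z => normal_peak 1 / binK a b * binG a b z))//.
- rewrite -EFinB; congr (_%:E); rewrite -[RHS]subr0; congr (_ - _).
  have -> : binG a b lo = 0 :> R.
    rewrite /binG /lo mulrN mulrC divfK ?gt_eqF// subrr.
    by rewrite binE_p0.
  by rewrite mulr0.
- apply: continuous_subspaceT => z.
  by apply: cvgMl_tmp; exact: continuous_bkernel.
- split.
  + by move=> z _; have [] := dF z.
  + by apply: cvg_at_right_filter; exact: cF.
  + by apply: cvg_at_left_filter; exact: cF.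
- move=> z _; rewrite derive1E; have [_ ->] := dF z; exact: erefl.
Qed.

Definition kernel_majorant (z : R) : R := normal_peak 1 * expR ((1 - `|z|) / 2).

Lemma trunc_kernel_le a b y z :
  (`|trunc_kernel a b y z| <= (kernel_majorant z)%:E)%E.
Proof.
have pk : 0 <= normal_peak 1 :> R by exact: normal_peak_ge0.
rewrite /trunc_kernel patchE; case: ifPn => [|_]; last first.
  by rewrite abse0 lee_fin mulr_ge0// expR_ge0.
rewrite inE => /and5P[a0 b0 h1 zy h2].
have s0 : 0 < scale a b :> R by exact: scale_gt0.
have hz : 0 <= mode a b + scale a b * z <= 1.
  by rewrite h1/= (le_trans _ h2)// lerD2l ler_pM2l.
rewrite abse_EFin lee_fin ger0_norm; last by apply: mulr_ge0 => //; exact: bkernel_ge0.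
by rewrite ler_wpM2l// bkernel_le_exp.
Qed.

Lemma integrable_kernel_majorant :
  mu.-integrable setT (EFin \o kernel_majorant).
Proof.
have cm : continuous kernel_majorant.
  move=> z; apply: cvgMl_tmp; apply: (@continuous_cvg _ _ _ _ _ _ (@expR R)).
    exact: continuous_expR.
  apply: cvgMr_tmp; apply: cvgB; first exact: cvg_cst.
  exact: norm_continuous.
have m0 z : 0 <= kernel_majorant z.
  by rewrite mulr_ge0 ?normal_peak_ge0// expR_ge0.
have half : 0 < 2^-1 :> R by rewrite invr_gt0.
apply/integrableP; split.
  by apply/measurable_EFinP; exact: continuous_measurable_fun.
under eq_integral do rewrite /= ger0_norm//.
rewrite (ge0_symfun_integralT m0 cm); last first.
  by move=> z; rewrite /kernel_majorant /= normrN.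
have mset : measurable ([set x | 0 <= x] : set (measurableTypeR R)).
  by rewrite -set_itvcy; exact: measurable_itv.
(* On the half line the majorant is [normal_peak 1] times 2 exp(1/2) times the exponential density
   of rate 1/2. *)
have := integrableS measurableT mset (@subsetT _ _) (integrableZl measurableT
  (normal_peak 1 * (2 * expR 2^-1)) (integrable_exponential_pdf half)).
move=> /integrableP[mf fin]; rewrite lte_mul_pinfty//.
rewrite (le_lt_trans _ fin)//; apply: ge0_le_integral => //.
- by move=> x _; rewrite lee_fin.
- by apply: measurable_funTS; apply/measurable_EFinP; exact: continuous_measurable_fun.
- by apply: measurableT_comp.
- move=> x /= x0; rewrite exponential_pdfE//=.
  rewrite lee_fin (le_trans _ (ler_norm _))//.
  rewrite /kernel_majorant ger0_norm//.
  have -> : (1 - x) / 2 = 2^-1 + - 2^-1 * x by ring.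
  by rewrite expRD le_eqVlt; apply/orP; left; apply/eqP; field.
Qed.

End truncated_kernel.

(** * The normal limit of binomial tails *)

Section central_limit.
Context {R : realType}.
Notation mu := (@lebesgue_measure R).
Variables (a b : nat -> nat).
Hypotheses (aoo : a n @[n --> \oo] --> \oo) (boo : b n @[n --> \oo] --> \oo).

Let alpha n : R := spread (a n) (b n) / (a n)%:R.
Let beta n : R := spread (a n) (b n) / (b n)%:R.

Let near_gt0 : \forall n \near \oo, (0 < a n)%N && (0 < b n)%N.
Proof.
near=> n; apply/andP; split; near: n; exact: near_leq.
Unshelve. all: by end_near. Qed.

Let alpha_cvg0 : alpha n @[n --> \oo] --> (0 : R).
Proof.
apply: (@squeeze0 _ _ (fun n => Num.sqrt (a n)%:R^-1)).
  apply: filterS near_gt0 => n /andP[a0 b0].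
  by rewrite spread_le_sqrtl// andbT divr_ge0// ltW// spread_gt0.
by rewrite -(@sqrtr0 R); apply: cvg_sqrt; exact: cvg_invn.
Qed.

Let beta_cvg0 : beta n @[n --> \oo] --> (0 : R).
Proof.
apply: (@squeeze0 _ _ (fun n => Num.sqrt (b n)%:R^-1)).
  apply: filterS near_gt0 => n /andP[a0 b0].
  by rewrite spread_le_sqrtr// andbT divr_ge0// ltW// spread_gt0.
by rewrite -(@sqrtr0 R); apply: cvg_sqrt; exact: cvg_invn.
Qed.

Lemma near_mode_scale (x_ : nat -> R) (x : R) : x_ n @[n --> \oo] --> x ->
  \forall n \near \oo,
    0 < mode (a n) (b n) + scale (a n) (b n) * x_ n < 1.
Proof.
move=> xx.
have ca : x_ n * alpha n @[n --> \oo] --> (0 : R).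
  by rewrite -(mulr0 x); apply: cvgM.
have cb : x_ n * beta n @[n --> \oo] --> (0 : R).
  by rewrite -(mulr0 x); apply: cvgM.
near=> n.
have /andP[a0 b0] : (0 < a n)%N && (0 < b n)%N by near: n; exact: near_gt0.
have h1 : `|x_ n * alpha n| < 1.
  rewrite -normrN -[- _]sub0r; near: n.
  by apply: cvgr_dist_lt => //; exact: ltr01.
have h2 : `|x_ n * beta n| < 1.
  rewrite -normrN -[- _]sub0r; near: n.
  by apply: cvgr_dist_lt => //; exact: ltr01.
apply/andP; split.
  rewrite mode_scaleE// mulr_gt0 ?mode_gt0//.
  by move: h1; rewrite ltr_norml /alpha; lra.
rewrite -subr_gt0 mode_scaleC// mulr_gt0 ?subr_gt0 ?mode_lt1//.
by move: h2; rewrite ltr_norml /beta; lra.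
Unshelve. all: by end_near. Qed.

Lemma cvg_bkernel (z : R) :
  bkernel (a n) (b n) z @[n --> \oo] --> expR (- (z ^+ 2 / 2)).
Proof.
have ca : `|z| * alpha n @[n --> \oo] --> (0 : R).
  by rewrite -(mulr0 `|z|); apply: cvgMl_tmp; exact: alpha_cvg0.
have cb : `|z| * beta n @[n --> \oo] --> (0 : R).
  by rewrite -(mulr0 `|z|); apply: cvgMl_tmp; exact: beta_cvg0.
have half : 0 < 2^-1 :> R by rewrite invr_gt0.
have near_n : \forall n \near \oo, exists2 u, bkernel (a n) (b n) z = expR u &
    `|u + z ^+ 2 / 2| <= 2 * `|z| ^+ 3 * (alpha n + beta n).
  near=> n.
  have /andP[a0 b0] : (0 < a n)%N && (0 < b n)%N by near: n; exact: near_gt0.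
  by apply: bkernel_near => //; near: n; exact: near_cvg0_le.
apply: (@cvg_near_eq _ (fun n => expR (ln (bkernel (a n) (b n) z)))).
  by apply: filterS near_n => n [u -> _]; rewrite expRK.
apply: cvg_expR.
apply: (@cvg_dist0 _ _ (fun n => 2 * `|z| ^+ 3 * (alpha n + beta n))).
  by apply: filterS near_n => n [u -> h]; rewrite expRK opprK.
rewrite [X in _ --> X](_ : 0 = 2 * `|z| ^+ 3 * (0 + 0)); last by ring.
by apply: cvgMl_tmp; apply: cvgD.
Unshelve. all: by end_near. Qed.

Lemma cvg_trunc_kernel (y_ : nat -> R) (z : R) :
  (\forall n \near \oo, (z <= y_ n) &&
     (mode (a n) (b n) + scale (a n) (b n) * y_ n <= 1)) ->
  trunc_kernel (a n) (b n) (y_ n) z @[n --> \oo] --> (normal_pdf 0 1 z)%:E.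
Proof.
move=> zy; apply: cvg_trans (_ : (normal_peak 1 * bkernel (a n) (b n) z)%:E
    @[n --> \oo] --> _); last first.
  rewrite normal_pdf01E; apply: cvg_EFin; first exact: nearW.
  by apply: cvgMl_tmp; exact: cvg_bkernel.
apply: near_eq_cvg; near=> n.
have /andP[a0 b0] : (0 < a n)%N && (0 < b n)%N by near: n; exact: near_gt0.
have /andP[h1 h2] : (z <= y_ n) &&
  (mode (a n) (b n) + scale (a n) (b n) * y_ n <= 1) by near: n.
have /andP[h3 _] : 0 < mode (a n) (b n) + scale (a n) (b n) * z < 1.
  by near: n; exact: near_mode_scale (cvg_cst z).
rewrite /trunc_kernel patchE ifT// inE /kernel_domain_set /=.
by rewrite a0 b0 h1 h2 ltW.
Unshelve. all: by end_near. Qed.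

Lemma cvg_trunc_kernel0 (y_ : nat -> R) (z : R) :
  (\forall n \near \oo, y_ n < z) ->
  trunc_kernel (a n) (b n) (y_ n) z @[n --> \oo] --> 0%E.
Proof.
move=> yz; apply: (@cvg_near_eq _ (fun=> 0%E) _ _ _ (cvg_cst _)).
apply: filterS yz => n yz; rewrite /trunc_kernel patchE ifF//.
by apply/negbTE/negP; rewrite inE => /and5P[_ _ _]; rewrite leNgt yz.
Qed.

(** The argument moves with [n] because order statistics are centred at r / (n + 1), which differs
    from the mode. *)
Theorem binomial_clt (x_ : nat -> R) (x : R) : x_ n @[n --> \oo] --> x ->
  binG (a n) (b n) (x_ n) @[n --> \oo] --> fine (normal_prob 0 1 `]-oo, x]).
Proof.
move=> xx.
(* The right end of the domain, where the success probability is 1. *)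
pose hi n : R := (1 - mode (a n) (b n)) / scale (a n) (b n).
have near_hi : \forall n \near \oo, mode (a n) (b n) + scale (a n) (b n) * hi n = 1.
  apply: filterS near_gt0 => n /andP[a0 b0].
  by rewrite /hi mulrC divfK ?gt_eqF ?scale_gt0//; ring.
have le_hi z : \forall n \near \oo, (z <= hi n) &&
    (mode (a n) (b n) + scale (a n) (b n) * hi n <= 1).
  near=> n.
  have e : mode (a n) (b n) + scale (a n) (b n) * hi n = 1 by near: n.
  have /andP[a0 b0] : (0 < a n)%N && (0 < b n)%N by near: n; exact: near_gt0.
  have /andP[_ h3] : 0 < mode (a n) (b n) + scale (a n) (b n) * z < 1.
    by near: n; exact: near_mode_scale (cvg_cst z).
  rewrite e lexx andbT -(@ler_pM2l _ (scale (a n) (b n))) ?scale_gt0//; lra.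
have dct (y_ : nat -> R) (f : R -> \bar R) : measurable_fun setT f ->
    {ae mu, forall z, setT z -> trunc_kernel (a n) (b n) (y_ n) z @[n --> \oo] --> f z} ->
    (\int[mu]_z trunc_kernel (a n) (b n) (y_ n) z)%E @[n --> \oo] --> (\int[mu]_z f z)%E.
  move=> mf h; have [|||||_ _] // := @dominated_convergence _ _ R mu _ measurableT
    (fun n => trunc_kernel (a n) (b n) (y_ n)) f (EFin \o kernel_majorant).
  - by move=> n; exact: measurable_trunc_kernel.
  - exact: integrable_kernel_majorant.
  - by apply: aeW => z n _; exact: trunc_kernel_le.
have mphi : measurable_fun setT (EFin \o normal_pdf 0 (1 : R)).
  by apply/measurable_EFinP; exact: measurable_normal_pdf.
have tot : (\int[mu]_z trunc_kernel (a n) (b n) (hi n) z)%E @[n --> \oo] -->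
    (\int[mu]_z (normal_pdf 0 1 z)%:E)%E.
  by apply: dct => //; apply: aeW => z _; apply: cvg_trunc_kernel.
have part : (\int[mu]_z trunc_kernel (a n) (b n) (x_ n) z)%E @[n --> \oo] -->
    (\int[mu]_z ((EFin \o normal_pdf 0 (1 : R)) \_ `]-oo, x]) z)%E.
  apply: dct.
- apply/(measurable_restrictT _ (measurable_itv `]-oo, x])).
  exact: measurable_funTS.
(* Only [z = x] is excluded: elsewhere the comparison of [z] with [x_ n] is eventually that of [z]
   with [x]. *)
- exists [set x]; split; [exact: measurable_set1|exact: lebesgue_measure_set1|].
  move=> z /= hz; apply: contrapT => /eqP zx; apply: hz => _.
  rewrite patchE; case: ifPn => [|].
    rewrite inE/= in_itv/= => zlex; apply: cvg_trunc_kernel.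
    have {}zx : z < x by rewrite lt_neqAle zx.
    near=> n; apply/andP; split.
      by apply: ltW; near: n; apply: (cvgr_gt x).
    have /andP[_ h3] : 0 < mode (a n) (b n) + scale (a n) (b n) * x_ n < 1.
      by near: n; exact: near_mode_scale xx.
    exact: ltW.
  rewrite notin_setE/= in_itv/= => /negP; rewrite -ltNge => xz.
  by apply: cvg_trunc_kernel0; apply: (cvgr_lt x).
rewrite integral_normal_pdf in tot.
rewrite -integral_mkcond -/(normal_prob 0 1 _) in part.
have fin : normal_prob 0 1 `]-oo, x] \is a fin_num.
  exact: fin_num_measure.
rewrite -(fineK fin) in part.
(* The common factor of the two integrals cancels here, and [binG] is 1 at [hi n]. *)
have q : fine (\int[mu]_z trunc_kernel (a n) (b n) (x_ n) z) /
   fine (\int[mu]_z trunc_kernel (a n) (b n) (hi n) z)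
   @[n --> \oo] --> fine (normal_prob 0 1 `]-oo, x]) / 1.
  apply: cvgM; first exact: fine_cvg part.
  by apply: cvgV; [exact: oner_neq0|exact: fine_cvg tot].
rewrite divr1 in q; apply: cvg_near_eq q; near=> n.
have /andP[a0 b0] : (0 < a n)%N && (0 < b n)%N by near: n; exact: near_gt0.
have e : mode (a n) (b n) + scale (a n) (b n) * hi n = 1 by near: n.
have /andP[h1 h2] : 0 < mode (a n) (b n) + scale (a n) (b n) * x_ n < 1.
  by near: n; exact: near_mode_scale xx.
rewrite !integral_trunc_kernel ?e ?ltr01 ?lexx ?h1 ?(ltW h2)//=.
have -> : binG (a n) (b n) (hi n) = 1 :> R.
  by rewrite /binG e binE_p1 /tail_ind ltnS leq_addr.
have K0 : 0 < binK (a n) (b n) :> R by exact: binK_gt0.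
have p0 : 0 < normal_peak 1 :> R by exact: normal_peak_gt0.
by field; rewrite !gt_eqF.
Unshelve. all: by end_near. Qed.

End central_limit.

(** * Order statistics and counts *)

Section order_statistics.
Context {T : Type} {R : realType}.
Implicit Types (X : nat -> T -> R).

Definition count_le X (s : R) (n : nat) (w : T) : nat :=
  count (fun i => (X i w <= s)%R) (iota 0 n).

Lemma count_leS X s n w : count_le X s n.+1 w = ((X n w <= s)%R + count_le X s n w)%N.
Proof. by rewrite /count_le -[n.+1]addn1 iotaD count_cat /= addn0 addnC. Qed.

Lemma order_stat_le X (r n : nat) w s : (0 < r <= n)%N ->
  (order_stat X r n w <= s) = (r <= count_le X s n w)%N.
Proof.
move=> /andP[r0 rn]; rewrite /order_stat; set l := [seq X i w | i <- iota 0 n].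
have srt : sorted <=%O (sort <=%R l) by exact: sort_le_sorted.
have cnt : count (<= s) (sort <=%R l) = count_le X s n w.
  by rewrite count_sort /l count_map; exact: eq_count.
have sz : size (sort <=%R l) = n by rewrite size_sort size_map size_iota.
case: (leqP r) => h.
  by apply: nth_count_le => //; rewrite cnt prednK.
apply/negbTE; rewrite -ltNge; apply: nth_count_gt => //.
by rewrite cnt sz; apply/andP; split; lia.
Qed.

End order_statistics.

(** * Joint law of the two counts *)

Section counting_law.
Context {R : realType} {d : measure_display} {T : measurableType d}.
Variables (P : probability T R) (U V : nat -> {RV P >-> R}) (s t : R).
Variable p : bool -> bool -> R.

Definition cell (a b : bool) : set (R * R) :=
  [set x | ((x.1 <= s) == a) && ((x.2 <= t) == b)].

Hypothesis cellP : forall i a b, P ((fun w => (U i w, V i w)) @^-1` cell a b) = (p a b)%:E.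
Hypothesis indep : mutually_independent P (fun i w => (U i w, V i w)).

Lemma measurable_half_line (c : R) (a : bool) : measurable [set x : R | (x <= c) == a].
Proof.
case: a.
  rewrite (_ : [set _ | _] = [set` `]-oo, c]]); first exact: measurable_itv.
  by apply/seteqP; split => x /=; rewrite in_itv/= => /eqP// ->.
rewrite (_ : [set _ | _] = [set` `]c, +oo[]); first exact: measurable_itv.
apply/seteqP; split => x /=; rewrite in_itv/= andbT ltNge.
  by move=> /eqP ->.
by move=> /negbTE ->.
Qed.

Lemma measurable_cell a b : measurable (cell a b).
Proof.
rewrite (_ : cell a b = [set x : R | (x <= s) == a] `*` [set x : R | (x <= t) == b]).
  by apply: measurableX; exact: measurable_half_line.
apply/seteqP; split => x; first by move=> /andP[].
by move=> [/= h1 h2]; apply/andP.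
Qed.

Let Z i w := (U i w, V i w).

Let measurable_Z i : measurable_fun setT (Z i).
Proof. by apply: measurable_fun_pair; exact: measurable_funPT. Qed.

Let measurable_preZ i A : measurable A -> measurable (Z i @^-1` A).
Proof. by move=> mA; rewrite -[X in measurable X]setTI; exact: measurable_Z. Qed.

Let event (F : nat -> nat -> bool) n : set T :=
  [set w | F (count_le U s n w) (count_le V t n w)].

(** The counterpart for events of one unfolding of [binE2]. *)
Let eventS_cell F n a b :
  event F n.+1 `&` Z n @^-1` cell a b =
  event (fun i j => F (a + i)%N (b + j)%N) n `&` Z n @^-1` cell a b.
Proof.
apply/seteqP; split => w [h c]; split => //; move: h;
  by case/andP: c => /eqP/= ha /eqP/= hb; rewrite /event /= !count_leS ha hb.
Qed.

Let event_split A n : A =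
  (A `&` Z n @^-1` cell true true `|` A `&` Z n @^-1` cell true false) `|`
  (A `&` Z n @^-1` cell false true `|` A `&` Z n @^-1` cell false false).
Proof.
apply/seteqP; split => [w Aw|w]; last by do 2?[case => [[]|]] => //; case.
rewrite /Z /cell /=.
by case: (U n w <= s); case: (V n w <= t);
  [left; left|left; right|right; left|right; right]; split.
Qed.

Let measurable_event F n : measurable (event F n).
Proof.
elim: n F => [|n IH] F.
  rewrite /event /count_le /=; case: (F _ _).
    by rewrite (_ : [set _ | _] = setT)//; apply/seteqP; split.
  by rewrite (_ : [set _ | _] = set0)//; apply/seteqP; split.
rewrite (event_split (event F n.+1) n) !eventS_cell.
by do ?apply: measurableU; apply: measurableI => //; apply: measurable_preZ;
  exact: measurable_cell.
Qed.

Let probability_split (A : set T) n : measurable A ->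
  P A = (P (A `&` Z n @^-1` cell true true) + P (A `&` Z n @^-1` cell true false) +
   (P (A `&` Z n @^-1` cell false true) + P (A `&` Z n @^-1` cell false false)))%E.
Proof.
move=> mA.
have mAc a b : measurable (A `&` Z n @^-1` cell a b).
  by apply: measurableI => //; apply: measurable_preZ; exact: measurable_cell.
rewrite {1}(event_split A n) !measureU//.
- apply/seteqP; split => // w [[_ /andP[_ /eqP h1]] [_ /andP[_ /eqP h2]]].
  by rewrite h1 in h2.
- apply/seteqP; split => // w [[_ /andP[_ /eqP h1]] [_ /andP[_ /eqP h2]]].
  by rewrite h1 in h2.
- exact: measurableU.
- exact: measurableU.
- apply/seteqP; split => // w [h1 h2].
  have {}h1 : (U n w <= s) = true by case: h1 => [[_ /andP[/eqP]]|[_ /andP[/eqP]]].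
  by case: h2 => [[_ /andP[/eqP]]|[_ /andP[/eqP]]]; rewrite /= h1.
Qed.

Let future (l : seq nat) (A : nat -> set (R * R)) : set T := \bigcap_(i in [set` l]) Z i @^-1` A i.

Let measurable_future (l : seq nat) A : (forall i, measurable (A i)) -> measurable (future l A).
Proof.
move=> mA; apply: fin_bigcap_measurable => // i _; exact: measurable_preZ.
Qed.

(* Independence of the next observation from the past enters by carrying along
   an arbitrary product event [future l A] on indices not yet used. *)
Let counting_law_future (F : nat -> nat -> bool) n l A : uniq l -> (forall i, i \in l -> (n <= i)%N) ->
  (forall i, measurable (A i)) ->
  P (event F n `&` future l A) =
  ((binE2 p n (fun i j => (F i j)%:R))%:E * P (future l A))%E.
Proof.
elim: n F l A => [|n IH] F l A ul ln mA.
  rewrite /event /count_le /=; case: (F 0%N 0%N).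
    by rewrite (_ : [set _ | _] = setT) ?setTI ?mul1e//; apply/seteqP; split.
  by rewrite (_ : [set _ | _] = set0) ?set0I ?measure0 ?mul0e//; apply/seteqP; split.
rewrite (probability_split n); last first.
  by apply: measurableI; [exact: measurable_event|exact: measurable_future].
have nl : n \notin l by apply/negP => /ln; rewrite ltnn.
(* The cell of observation [n] joins the product event, now over [n :: l], to which the induction
   hypothesis applies; independence then splits the cell off again. *)
have key a b : P (event F n.+1 `&` future l A `&` Z n @^-1` cell a b) =
    ((binE2 p n (fun i j => (F (a + i)%N (b + j)%N)%:R) * p a b)%:E * P (future l A))%E.
  pose A' i := if i == n then cell a b else A i.
  have mA' i : measurable (A' i).
    by rewrite /A'; case: ifP => _ //; exact: measurable_cell.
  have fE : future (n :: l) A' = Z n @^-1` cell a b `&` future l A.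
    rewrite /future; apply/seteqP; split => w.
      move=> h; split; first by have := h n (mem_head _ _); rewrite /A' eqxx.
      move=> i il; have : i \in n :: l by rewrite inE (_ : i \in l)// orbT.
      move=> /h; rewrite /A'; case: eqP => // ein.
      by move: nl; rewrite -ein (_ : i \in l).
    move=> [h1 h2] i; rewrite /= inE /A' => /orP[/eqP ->|il]; first by rewrite eqxx.
    case: eqP => [ein|_]; last exact: h2.
    by move: nl; rewrite -ein il.
  rewrite setIAC eventS_cell -setIA -fE IH//=.
  - have -> : P (future (n :: l) A') = ((p a b)%:E * P (future l A))%E.
      rewrite /future indep ?big_cons//=; last by rewrite nl.
      rewrite /A' eqxx -/(Z n) cellP indep//; congr (_ * _)%E.
      apply: eq_big_seq => i il; case: eqP => // ein.
      by move: nl; rewrite -ein il.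
    by rewrite muleA EFinM.
  - by rewrite nl.
  - by move=> i; rewrite inE => /orP[/eqP ->//|/ln /ltnW].
have fin : P (future l A) \is a fin_num.
  by apply: fin_num_measure; exact: measurable_future.
by rewrite !key -(fineK fin) -!EFinM -!EFinD /=; congr (_%:E); ring.
Qed.

Theorem counting_law (F : nat -> nat -> bool) n :
  P [set w | F (count_le U s n w) (count_le V t n w)] =
  (binE2 p n (fun i j => (F i j)%:R))%:E.
Proof.
have f0 : future [::] (fun=> setT) = setT by apply/seteqP; split.
have := @counting_law_future F n [::] (fun=> setT) isT.
by rewrite f0 setIT probability_setT mule1; apply.
Qed.

Lemma measurable_counting_event (F : nat -> nat -> bool) n :
  measurable [set w | F (count_le U s n w) (count_le V t n w)].
Proof. exact: measurable_event. Qed.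

End counting_law.

(** * The uniform distribution function *)

Section copula_cells.
Context {R : realType}.

(** This is [s] clipped to [0, 1]; rescaling produces thresholds that may leave this interval. *)
Definition unif_cdf (s : R) : R := fine (uniform_prob (@ltr01 R) `]-oo, s]).

Lemma unif_cdf_ge1 s : 1 <= s -> unif_cdf s = 1.
Proof.
move=> s1; rewrite /unif_cdf /uniform_prob integral_uniform_pdf1//.
by move=> x; rewrite /= !in_itv/= => /andP[_ x1]; exact: le_trans s1.
Qed.

Lemma unif_cdf_id s : 0 < s < 1 -> unif_cdf s = s.
Proof.
move=> /andP[s0 s1]; rewrite /unif_cdf /uniform_prob integral_uniform_pdf.
rewrite (_ : `]-oo, s] `&` `[0, 1] = [set` `[0, s]]); last first.
  apply/seteqP; split => x /=; rewrite !in_itv/=.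
    by move=> [xs /andP[-> _]].
  by move=> /andP[-> xs]; rewrite xs (le_trans xs (ltW s1)).
rewrite (eq_integral (cst 1%E)); last first.
  move=> x; rewrite inE/= in_itv/= => /andP[x0 xs].
  by rewrite /uniform_pdf x0 (le_trans xs (ltW s1)) subr0 invr1.
rewrite integral_cst//= mul1e lebesgue_measure_itv/= lte_fin s0.
by rewrite -EFinB subr0.
Qed.

End copula_cells.

Section events.
Context {R : realType} {d : measure_display} {T : measurableType d}.
Variable P : probability T R.

Lemma measurable_rv_le (X : {RV P >-> R}) (c : R) : measurable [set w | X w <= c].
Proof.
rewrite (_ : [set _ | _] = X @^-1` [set` `]-oo, c]]).
  by rewrite -[X in measurable X]setTI; exact: measurable_funPT.
by apply/seteqP; split => w /=; rewrite in_itv.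
Qed.

Lemma probability_setI1 (A B : set T) : measurable A -> measurable B ->
  P B = 1%E -> P (A `&` B) = P A.
Proof.
move=> mA mB PB; rewrite (measureDI P mA mB) [X in (X + _)%E](_ : _ = 0%E) ?add0e//.
apply: (@subset_measure0 _ _ _ P _ (~` B)) => //.
- exact: measurableD.
- exact: measurableC.
- by have := probability_setC P mB; rewrite PB subee.
Qed.

Lemma has_law_le (X : {RV P >-> R}) (mu : set R -> \bar R) c : has_law X mu ->
  P [set w | X w <= c] = mu [set` `]-oo, c]].
Proof.
move=> lX; rewrite -lX; last exact: measurable_itv.
rewrite /distribution/= /pushforward; congr (P _).
Qed.

Lemma fineK_probability (A : set T) : measurable A -> (fine (P A))%:E = P A.
Proof. by move=> mA; rewrite fineK//; exact: fin_num_measure. Qed.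

End events.

(** * Cell probabilities and covariance of a copula *)

Section copula.
Context {R : realType}.
Variable C : R * R -> R.
Hypothesis hC : is_copula C.

Lemma copula_marginals s : C (s, 1) = unif_cdf s /\ C (1, s) = unif_cdf s.
Proof.
have [d0 [T0 [P0 [U0 [V0 [lU lV CE]]]]]] := hC.
have law (X : {RV P0 >-> R}) c : has_law X (uniform_prob (@ltr01 R)) ->
    P0 [set w | X w <= c] = (unif_cdf c)%:E.
  by move=> lX; rewrite /unif_cdf -(has_law_le _ lX) fineK_probability//; exact: measurable_rv_le.
have full (X : {RV P0 >-> R}) : has_law X (uniform_prob (@ltr01 R)) ->
    P0 [set w | X w <= 1] = 1%E.
  by move=> lX; rewrite law// unif_cdf_ge1.
split; apply: EFin_inj; rewrite -CE /joint_cdf /=.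
- rewrite -(law U0 s lU) -(probability_setI1 (measurable_rv_le U0 s) (measurable_rv_le V0 1))//.
  exact: full.
- rewrite -(law V0 s lV) -(probability_setI1 (measurable_rv_le V0 s) (measurable_rv_le U0 1))//.
    by rewrite setIC.
  exact: full.
Qed.

Definition copula_cell (s t : R) (a b : bool) : R :=
  match a, b with
  | true, true => C (s, t)
  | true, false => unif_cdf s - C (s, t)
  | false, true => unif_cdf t - C (s, t)
  | false, false => 1 - unif_cdf s - unif_cdf t + C (s, t)
  end.

Context {d : measure_display} {T : measurableType d}.
Variables (P : probability T R) (U V : {RV P >-> R}).
Hypothesis UV_C : forall p, joint_cdf P (fun w => (U w, V w)) p = (C p)%:E.

(** The data about [U] and [V] are joint probabilities only. Since C(1, 1) = 1, both events have
    full probability, and the marginals can be read off by setting the other coordinate to 1. *)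
Let full_square : P [set w | U w <= 1] = 1%E /\ P [set w | V w <= 1] = 1%E.
Proof.
have c11 : P ([set w | U w <= 1] `&` [set w | V w <= 1]) = 1%E.
  have := UV_C (1, 1); rewrite /joint_cdf /= => e.
  by rewrite [LHS]e (copula_marginals 1).1 unif_cdf_ge1.
pose AB := [set w | U w <= 1] `&` [set w | V w <= 1].
have mAB : measurable AB by apply: measurableI; exact: measurable_rv_le.
have aux (E : set T) : measurable E -> AB `<=` E -> P E = 1%E.
  move=> mE sE; apply: le_anti; rewrite probability_le1//=.
  apply: (@le_trans _ _ (P AB)); first by rewrite /AB c11.
  by apply: le_measure; rewrite ?inE.
by split; apply: aux; do ?[exact: measurable_rv_le]; move=> w [].
Qed.

Let marginalU s : P [set w | U w <= s] = (unif_cdf s)%:E.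
Proof.
rewrite -(probability_setI1 (measurable_rv_le U s) (measurable_rv_le V 1)) ?full_square.2//.
have := UV_C (s, 1); rewrite /joint_cdf /= => e.
by rewrite [LHS]e (copula_marginals s).1.
Qed.

Let marginalV t : P [set w | V w <= t] = (unif_cdf t)%:E.
Proof.
rewrite -(probability_setI1 (measurable_rv_le V t) (measurable_rv_le U 1)) ?full_square.1//.
rewrite setIC; have := UV_C (1, t); rewrite /joint_cdf /= => e.
by rewrite [LHS]e (copula_marginals t).2.
Qed.

Lemma copula_cellP s t a b :
  P ((fun w => (U w, V w)) @^-1` cell s t a b) = (copula_cell s t a b)%:E.
Proof.
pose A := [set w | U w <= s]; pose B := [set w | V w <= t].
have mA : measurable A by exact: measurable_rv_le.
have mB : measurable B by exact: measurable_rv_le.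
have PAB : P (A `&` B) = (C (s, t))%:E by rewrite -UV_C.
have fin E : measurable E -> P E \is a fin_num by move=> mE; exact: fin_num_measure.
have diff E : measurable E -> P (E `\` B) = (P E - P (E `&` B))%E.
  move=> mE; rewrite [in RHS](measureDI P mE mB) addeK// fin//; exact: measurableI.
have PAcB : P (~` A `&` B) = (unif_cdf t - C (s, t))%:E.
  have : P B = (P (B `\` A) + P (B `&` A))%E by exact: measureDI.
  rewrite (marginalV t : P B = _) setDE setIC [B `&` A]setIC PAB => h.
  by rewrite EFinB h addeK.
case: a; case: b; rewrite /copula_cell.
- rewrite -PAB; congr (P _); apply/seteqP; split => w /=.
    by move=> /andP[/eqP h1 /eqP h2].
  by rewrite /A /B /cell /= => -[-> ->].
- rewrite EFinB -(marginalU s) -PAB -diff//; congr (P _); apply/seteqP; split => w.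
    by rewrite /A /B /cell /= => /andP[/eqP h1 /eqP h2]; rewrite h1 h2; split.
  by move=> [/= h1 /negP h2]; rewrite /cell /= (_ : U w <= s) //= (negbTE h2).
- rewrite -PAcB; congr (P _); apply/seteqP; split => w.
    by rewrite /A /B /cell /= => /andP[/eqP h1 /eqP h2]; rewrite h1 h2; split.
  by move=> [/= /negP h1 h2]; rewrite /cell /= (negbTE h1) (_ : V w <= t).
- have -> : (1 - unif_cdf s - unif_cdf t + C (s, t))%:E =
      (P (~` A) - P (~` A `&` B))%E.
    by rewrite probability_setC// marginalU PAcB -!EFinB; congr (_%:E); ring.
  rewrite -diff; last exact: measurableC.
  congr (P _); apply/seteqP; split => w.
    by rewrite /A /B /cell /= => /andP[/eqP h1 /eqP h2]; rewrite h1 h2; split.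
  by move=> [/= /negP h1 /negP h2]; rewrite /cell /= (negbTE h1) (negbTE h2).
Qed.

Lemma copula_cell_ge0 s t a b : 0 <= copula_cell s t a b.
Proof. by rewrite -lee_fin -copula_cellP; exact: measure_ge0. Qed.

Lemma copula_cell_sum s t :
  copula_cell s t true true + copula_cell s t true false +
  copula_cell s t false true + copula_cell s t false false = 1.
Proof. by rewrite /copula_cell; ring. Qed.

(** Non-negative cells give the Fréchet-Hoeffding bounds; with u and v the clipped [s] and [t], the
    difference lies between -(1 - u) (1 - v) and u (1 - v). *)
Lemma copula_cov_le s t :
  `|C (s, t) - unif_cdf s * unif_cdf t| <= 1 - unif_cdf t.
Proof.
have := copula_cell_ge0 s t true true; have := copula_cell_ge0 s t true false.
have := copula_cell_ge0 s t false true; have := copula_cell_ge0 s t false false.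
rewrite /copula_cell ler_norml => *; apply/andP; split; nra.
Qed.

End copula.

(** * Asymptotic independence *)

Section decoupling.
Context {R : realType}.

(** [w] is the integer part of e sqrt A, plus 1: small against the standard deviation, so that the
    window is improbable, yet proportional to it, so that the covariance is divided by the full
    scale. *)
Lemma near_window (A : nat -> nat) (e : R) : A n @[n --> \oo] --> \oo ->
  0 < e <= 8^-1 -> \forall n \near \oo, exists w,
    [/\ (0 < w)%N, e * Num.sqrt (A n)%:R <= w%:R, (w.*2 <= A n)%N &
        w%:R / Num.sqrt (A n)%:R <= 2 * e].
Proof.
move=> Aoo /andP[e0 e8].
have sq : Num.sqrt ((A n)%:R^-1 : R) @[n --> \oo] --> (0 : R).
  by rewrite -(@sqrtr0 R); apply: cvg_sqrt; exact: cvg_invn.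
have small := near_cvg0_le sq e0.
near=> n.
have A8 : (8 <= A n)%N by near: n; exact: near_leq.
have A0 : 1 <= (A n)%:R :> R by rewrite ler1n; lia.
have A8' : 8 <= (A n)%:R :> R by rewrite ler_nat.
have s0 : 0 < Num.sqrt (A n)%:R :> R by rewrite sqrtr_gt0; lra.
have s1 : Num.sqrt (A n)%:R <= (A n)%:R :> R.
  have s1 : 1 <= Num.sqrt (A n)%:R :> R by rewrite -[leLHS]sqrtr1 ler_wsqrtr.
  by rewrite -[leRHS]sqr_sqrtr// expr2 ler_peMr// ltW.
have i1 : (Num.sqrt (A n)%:R)^-1 <= e :> R.
  by rewrite -sqrtrV//; near: n; exact: small.
have x0 : 0 <= e * Num.sqrt (A n)%:R by rewrite mulr_ge0// ltW.
exists (Num.truncn (e * Num.sqrt (A n)%:R)).+1.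
have /andP[t1 t2] := truncn_itv x0.
split => //; first exact: ltW.
- rewrite -(@ler_nat R) -muln2 natrM -natr1; nra.
- rewrite ler_pdivrMr// -natr1.
  have : 1 <= e * Num.sqrt (A n)%:R by rewrite -ler_pdivrMr// mul1r.
  lra.
Unshelve. all: by end_near. Qed.

Lemma joint_tail_limit (p : nat -> bool -> bool -> R) (u v : nat -> R)
    (r r' : nat -> nat) (l l' : R) :
  (forall n a b, 0 <= p n a b) ->
  (forall n, p n true true + p n true false + p n false true + p n false false = 1) ->
  (forall n, u n = p n true true + p n true false) ->
  (forall n, v n = p n true true + p n false true) ->
  (forall e, 0 < e -> \forall n \near \oo, exists w w', [/\ (0 < w)%N, (0 < w')%N &
    n%:R * `|p n true true - u n * v n| / (w%:R * w'%:R) +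
    (binE (u n) n (window (r n) w) + binE (v n) n (window (r' n) w')) *+ 2 <= e]) ->
  binE (u n) n (tail_ind (r n)) @[n --> \oo] --> l ->
  binE (v n) n (tail_ind (r' n)) @[n --> \oo] --> l' ->
  binE2 (p n) n (fun a b => tail_ind (r n) a * tail_ind (r' n) b) @[n --> \oo]
    --> l * l'.
Proof.
move=> p0 psum uE vE small ul vl.
have d0 : (binE2 (p n) n (fun a b => tail_ind (r n) a * tail_ind (r' n) b) -
   binE (u n) n (tail_ind (r n)) * binE (v n) n (tail_ind (r' n))) @[n --> \oo]
   --> (0 : R).
  apply/cvgrPdist_le => e /small; apply: filterS => n [w [w' [w0 w'0 h]]].
  rewrite sub0r normrN; apply: le_trans h; rewrite uE vE.
  exact: (tail_cov _ _ _ (p0 n) (psum n) w0 w'0).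
rewrite -[l * l']add0r; apply: cvg_near_eq (cvgD d0 (cvgM ul vl)).
by apply: nearW => n /=; exact: subrK.
Qed.

Lemma window1 (r m : nat) : window r 1 m = 0 :> R.
Proof. by rewrite /window addn1 ltnS ltnNge; case: leqP. Qed.

Lemma cvg_nat_pinfty (k : nat -> nat) :
  (forall m, \forall n \near \oo, (m <= k n)%N) -> k n @[n --> \oo] --> \oo.
Proof.
move=> km; apply/(@cvgrnyP R); apply/cvgryPge => B.
apply: filterS (km (Num.truncn `|B|).+1) => n h.
rewrite (le_trans (ler_norm B))//.
have /andP[_ t2] := truncn_itv (normr_ge0 B).
by rewrite (le_trans (ltW t2))// ler_nat.
Qed.

Lemma cvg_minn (a b : nat -> nat) : a n @[n --> \oo] --> \oo ->
  b n @[n --> \oo] --> \oo -> minn (a n) (b n) @[n --> \oo] --> \oo.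
Proof.
move=> aoo boo; apply: cvg_nat_pinfty => m; near=> n.
by rewrite leq_min; apply/andP; split; near: n; exact: near_leq.
Unshelve. all: by end_near. Qed.

Lemma near_window_error (u : nat -> R) (r a b : nat -> nat) (e : R) :
  (forall n, 0 <= u n <= 1) ->
  a n @[n --> \oo] --> \oo -> b n @[n --> \oo] --> \oo ->
  (\forall n \near \oo, n = (a n + b n).+1 /\ r n = (a n).+1) ->
  0 < e <= 8^-1 ->
  \forall n \near \oo, exists w, [/\ (0 < w)%N,
    e * Num.sqrt (minn (a n) (b n))%:R <= w%:R &
    binE (u n) n (window (r n) w) <= 4 * expR 1 * e].
Proof.
move=> u01 aoo boo nE e08; have Aoo := cvg_minn aoo boo.
near=> n.
have [w [w0 ew wA wA2]] : exists w, [/\ (0 < w)%N,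
   e * Num.sqrt (minn (a n) (b n))%:R <= w%:R, (w.*2 <= minn (a n) (b n))%N &
   w%:R / Num.sqrt (minn (a n) (b n))%:R <= 2 * e].
  by near: n; exact: near_window.
have [nE1 rE] : n = (a n + b n).+1 /\ r n = (a n).+1 by near: n.
exists w; split => //; rewrite rE {2}nE1.
have A8 : (8 <= minn (a n) (b n))%N by near: n; exact: near_leq.
apply: (le_trans (binE_window_le A8 _ _ wA (u01 n))).
- exact: geq_minl.
- exact: geq_minr.
- have e1 : 0 <= 2 * expR 1 :> R by rewrite mulr_ge0// expR_ge0.
  have := ler_wpM2l e1 wA2; lra.
Unshelve. all: by end_near. Qed.

(** The second count has fluctuations of bounded size, so a wide window would not be improbable;
    [w' = 1] leaves no window at all. The bounded covariance is then divided by [w] alone, which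
    tends to infinity. *)
Lemma small_error_poisson (u v dl : nat -> R) (r r' a b : nat -> nat) (M : R) :
  (forall n, 0 <= u n <= 1) ->
  a n @[n --> \oo] --> \oo -> b n @[n --> \oo] --> \oo ->
  (\forall n \near \oo, n = (a n + b n).+1 /\ r n = (a n).+1) ->
  (\forall n \near \oo, n%:R * `|dl n| <= M) ->
  forall e, 0 < e -> \forall n \near \oo, exists w w', [/\ (0 < w)%N, (0 < w')%N &
    n%:R * `|dl n| / (w%:R * w'%:R) +
    (binE (u n) n (window (r n) w) + binE (v n) n (window (r' n) w')) *+ 2 <= e].
Proof.
move=> u01 aoo boo nE nM e e0.
have Aoo := cvg_minn aoo boo.
have e1 : 0 < expR 1 :> R by exact: expR_gt0.
(* Twice one window error, 4 exp(1) f, must be at most e/2. *)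
pose f := Num.min 8^-1 (e / (16 * expR 1)).
have f0 : 0 < f <= 8^-1.
  have q : 0 < e / (16 * expR 1) by rewrite divr_gt0// mulr_gt0.
  by rewrite /f lt_min q ge_min lexx invr_gt0 ltr0n.
have fe : 8 * expR 1 * f <= e / 2.
  have : f <= e / (16 * expR 1) by rewrite /f ge_min lexx orbT.
  by rewrite ler_pdivlMr ?mulr_gt0//; lra.
have c0 : M / f * Num.sqrt ((minn (a n) (b n))%:R^-1) @[n --> \oo] --> (0 : R).
  rewrite -(mulr0 (M / f)); apply: cvgMl_tmp.
  by rewrite -(@sqrtr0 R); apply: cvg_sqrt; exact: cvg_invn.
near=> n.
have A1 : (1 <= minn (a n) (b n))%N by near: n; exact: near_leq.
have [w [w0 ew hw]] : exists w, [/\ (0 < w)%N,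
    f * Num.sqrt (minn (a n) (b n))%:R <= w%:R &
    binE (u n) n (window (r n) w) <= 4 * expR 1 * f].
  by near: n; exact: near_window_error.
have hM : n%:R * `|dl n| <= M by near: n.
exists w, 1%N; split => //.
rewrite (@eq_binE _ (v n) n (window (r' n) 1) (fun=> 0)) ?binE_cst ?addr0; last first.
  by move=> m _; exact: window1.
rewrite mulr1.
have sA : 0 < Num.sqrt (minn (a n) (b n))%:R :> R by rewrite sqrtr_gt0 ltr0n.
have h1 : n%:R * `|dl n| / w%:R <= M / f * Num.sqrt ((minn (a n) (b n))%:R^-1).
  rewrite ler_pdivrMr ?ltr0n// (le_trans hM)//.
  have M0 : 0 <= M by apply: le_trans hM; rewrite mulr_ge0.
  have /andP[fpos _] := f0; rewrite sqrtrV// -mulrA mulrAC.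
  rewrite -[leLHS]mulr1 -mulrA ler_wpM2l//.
  by rewrite -invfM ler_pdivlMr ?mul1r ?mulr_gt0.
have h2 : M / f * Num.sqrt ((minn (a n) (b n))%:R^-1) <= e / 2.
  by near: n; apply: near_cvg0_le => //; rewrite divr_gt0.
by rewrite mulr2n; lra.
Unshelve. all: by end_near. Qed.

(** With A and A' the two minima, the covariance is at most M A' and w w' is at least f^2 sqrt(A
    A'), so their quotient is at most (M / f^2) sqrt(A' / A). *)
Lemma small_error_normal (u v dl : nat -> R) (r r' a b a' b' : nat -> nat) (M : R) :
  (forall n, 0 <= u n <= 1) -> (forall n, 0 <= v n <= 1) ->
  a n @[n --> \oo] --> \oo -> b n @[n --> \oo] --> \oo ->
  a' n @[n --> \oo] --> \oo -> b' n @[n --> \oo] --> \oo ->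
  (\forall n \near \oo, n = (a n + b n).+1 /\ r n = (a n).+1) ->
  (\forall n \near \oo, n = (a' n + b' n).+1 /\ r' n = (a' n).+1) ->
  (\forall n \near \oo, n%:R * `|dl n| <= M * (minn (a' n) (b' n))%:R) ->
  ((minn (a' n) (b' n))%:R / (minn (a n) (b n))%:R : R) @[n --> \oo] --> (0 : R) ->
  forall e, 0 < e -> \forall n \near \oo, exists w w', [/\ (0 < w)%N, (0 < w')%N &
    n%:R * `|dl n| / (w%:R * w'%:R) +
    (binE (u n) n (window (r n) w) + binE (v n) n (window (r' n) w')) *+ 2 <= e].
Proof.
move=> u01 v01 aoo boo aoo' boo' nE nE' nM A'A e e0.
have Aoo := cvg_minn aoo boo; have Aoo' := cvg_minn aoo' boo'.
have e1 : 0 < expR 1 :> R by exact: expR_gt0.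
(* Two windows now, hence twice the previous denominator. *)
pose f := Num.min 8^-1 (e / (32 * expR 1)).
have f0 : 0 < f <= 8^-1.
  have q : 0 < e / (32 * expR 1) by rewrite divr_gt0// mulr_gt0.
  by rewrite /f lt_min q ge_min lexx invr_gt0 ltr0n.
have fe : 16 * expR 1 * f <= e / 2.
  have : f <= e / (32 * expR 1) by rewrite /f ge_min lexx orbT.
  by rewrite ler_pdivlMr ?mulr_gt0//; lra.
have c0 : M / f ^+ 2 * Num.sqrt ((minn (a' n) (b' n))%:R / (minn (a n) (b n))%:R)
    @[n --> \oo] --> (0 : R).
  rewrite -(mulr0 (M / f ^+ 2)); apply: cvgMl_tmp.
  by rewrite -(@sqrtr0 R); apply: cvg_sqrt.
near=> n.
have A1 : (1 <= minn (a n) (b n))%N by near: n; exact: near_leq.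
have A1' : (1 <= minn (a' n) (b' n))%N by near: n; exact: near_leq.
have [w [w0 ew hw]] : exists w, [/\ (0 < w)%N,
    f * Num.sqrt (minn (a n) (b n))%:R <= w%:R &
    binE (u n) n (window (r n) w) <= 4 * expR 1 * f].
  by near: n; exact: near_window_error.
have [w' [w'0 ew' hw']] : exists w, [/\ (0 < w)%N,
    f * Num.sqrt (minn (a' n) (b' n))%:R <= w%:R &
    binE (v n) n (window (r' n) w) <= 4 * expR 1 * f].
  by near: n; exact: near_window_error.
have hM : n%:R * `|dl n| <= M * (minn (a' n) (b' n))%:R by near: n.
exists w, w'; split => //.
have h2 : M / f ^+ 2 * Num.sqrt ((minn (a' n) (b' n))%:R / (minn (a n) (b n))%:R) <= e / 2.
  by near: n; apply: near_cvg0_le => //; rewrite divr_gt0.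
suff h1 : n%:R * `|dl n| / (w%:R * w'%:R) <=
    M / f ^+ 2 * Num.sqrt ((minn (a' n) (b' n))%:R / (minn (a n) (b n))%:R).
  by rewrite mulr2n; lra.
move: A1 A1' ew ew' hM; set A := minn (a n) _; set A' := minn (a' n) _.
move=> A1 A1' ew ew' hM.
have sA : 0 < Num.sqrt A%:R :> R by rewrite sqrtr_gt0 ltr0n.
have sA' : 0 < Num.sqrt A'%:R :> R by rewrite sqrtr_gt0 ltr0n.
have /andP[fpos _] := f0.
have M0 : 0 <= M.
  rewrite -(@pmulr_lge0 _ A'%:R) ?ltr0n//.
  by apply: le_trans hM; rewrite mulr_ge0.
rewrite ler_pdivrMr ?mulr_gt0 ?ltr0n//; apply: (le_trans hM).
have ww : (f * Num.sqrt A%:R) * (f * Num.sqrt A'%:R) <= w%:R * w'%:R.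
  by rewrite ler_pM// mulr_ge0// ltW.
have K0 : 0 <= M / f ^+ 2 * Num.sqrt (A'%:R / A%:R).
  by rewrite mulr_ge0 ?divr_ge0 ?sqrtr_ge0 ?exprn_ge0// ltW.
apply: le_trans (ler_wpM2l K0 ww).
rewrite sqrtrM// sqrtrV// le_eqVlt; apply/orP; left; apply/eqP.
rewrite -{1}(@sqr_sqrtr R A'%:R)//; field.
by rewrite !gt_eqF.
Unshelve. all: by end_near. Qed.

End decoupling.

(** * Centring and norming constants in the regimes *)

Section scaling.
Context {R : realType}.

Lemma spreadC (a b : nat) : spread a b = spread b a :> R.
Proof. by rewrite /spread [b%:R * _]mulrC [(b + a)%N]addnC. Qed.

Lemma scaleC (a b : nat) : scale a b = scale b a :> R.
Proof. by rewrite /scale spreadC addnC. Qed.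

(** A single square root reduces the limits of norming ratios to those of rational expressions. *)
Lemma div_scale (a b : nat) (c : R) : (0 < a)%N -> (0 < b)%N -> 0 <= c ->
  c / scale a b = Num.sqrt (c ^+ 2 * (a%:R + b%:R) ^+ 3 / (a%:R * b%:R)).
Proof.
move=> a0 b0 c0; have s0 : 0 < scale a b :> R by exact: scale_gt0.
have A0 : 0 < a%:R :> R by rewrite ltr0n.
have B0 : 0 < b%:R :> R by rewrite ltr0n.
rewrite -[LHS]ger0_norm; last by rewrite divr_ge0// ltW.
rewrite -sqrtr_sqr; congr (Num.sqrt _).
rewrite expr_div_n /scale expr_div_n sqr_spread// natrD; field.
by rewrite !gt_eqF// addr_gt0.
Qed.

(** The centring r / (n + 1) is the mean of a beta law, whereas [binG] is centred at its mode.
    Measured in units of [scale], the gap is (b - a) / (a + b + 2) over the spread. *)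
Lemma mode_offset (a b : nat) : (0 < a)%N -> (0 < b)%N ->
  `|(a.+1%:R / ((a + b).+1 + 1)%:R - mode a b) / scale a b| <= (spread a b)^-1 :> R.
Proof.
move=> a0 b0; have s0 : 0 < spread a b :> R by exact: spread_gt0.
have A0 : 0 < a%:R :> R by rewrite ltr0n.
have B0 : 0 < b%:R :> R by rewrite ltr0n.
have -> : (a.+1%:R / ((a + b).+1 + 1)%:R - mode a b) / scale a b =
    (b%:R - a%:R) / (a%:R + b%:R + 2) * (spread a b)^-1 :> R.
  rewrite /mode /scale addn1 -!natr1 natrD; field.
  by rewrite !gt_eqF ?addr_gt0.
have si : 0 < (spread a b)^-1 :> R by rewrite invr_gt0.
have d0 : 0 < a%:R + b%:R + 2 :> R by rewrite !addr_gt0.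
rewrite normrM (gtr0_norm si) ler_piMl ?(ltW si)//.
rewrite normrM normfV (gtr0_norm d0) ler_pdivrMr// mul1r ler_norml.
by apply/andP; split; lra.
Qed.

Section sequences.
Variables (a b : nat -> nat).
Hypotheses (aoo : a n @[n --> \oo] --> \oo) (boo : b n @[n --> \oo] --> \oo).

Lemma cvg_inv_spread : (spread (a n) (b n))^-1 @[n --> \oo] --> (0 : R).
Proof.
apply: (@cvg_near_eq _ (fun n => Num.sqrt ((a n)%:R^-1 + (b n)%:R^-1))).
  near=> n.
  have a0 : (0 < a n)%N by near: n; exact: near_leq.
  have b0 : (0 < b n)%N by near: n; exact: near_leq.
  have A0 : 0 < (a n)%:R :> R by rewrite ltr0n.
  have B0 : 0 < (b n)%:R :> R by rewrite ltr0n.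
  rewrite /spread -sqrtrV ?divr_ge0// natrD; congr (Num.sqrt _); field.
  by rewrite !gt_eqF// addr_gt0.
rewrite [X in _ --> X](_ : 0 = Num.sqrt (0 + 0) :> R); last by rewrite addr0 sqrtr0.
apply: cvg_sqrt.
by apply: cvgD; exact: cvg_invn.
Unshelve. all: by end_near. Qed.

(** [c n] is the inverse of the norming constant and [s n] the level compared with the order
    statistic; in the coordinates of [binG] this level tends to kappa x. *)
Lemma normal_margin (r : nat -> nat) (c : nat -> R) (kappa x : R) :
  (\forall n \near \oo, n = (a n + b n).+1 /\ r n = (a n).+1) ->
  c n / scale (a n) (b n) @[n --> \oo] --> kappa ->
  let s n := (r n)%:R / (n + 1)%:R + c n * x in
  (\forall n \near \oo, 0 < s n < 1) /\
  binE (unif_cdf (s n)) n (tail_ind (r n)) @[n --> \oo] -->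
    fine (normal_prob 0 1 `]-oo, kappa * x]).
Proof.
move=> nr ck s.
pose x_ n := (s n - mode (a n) (b n)) / scale (a n) (b n).
have near_gt0 : \forall n \near \oo, (0 < a n)%N && (0 < b n)%N.
  near=> n; apply/andP; split; near: n; exact: near_leq.
have xx : x_ n @[n --> \oo] --> kappa * x.
  have h1 : c n / scale (a n) (b n) * x @[n --> \oo] --> kappa * x.
    by apply: cvgMr_tmp.
  have h2 : x_ n - c n / scale (a n) (b n) * x @[n --> \oo] --> (0 : R).
    apply: cvg_dist0 cvg_inv_spread; near=> n.
    have /andP[a0 b0] : (0 < a n)%N && (0 < b n)%N by near: n.
    have [nE rE] : n = (a n + b n).+1 /\ r n = (a n).+1 by near: n.
    rewrite subr0 (_ : x_ n - _ = ((a n).+1%:R / ((a n + b n).+1 + 1)%:R -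
      mode (a n) (b n)) / scale (a n) (b n)); first exact: mode_offset.
    by rewrite -nE -rE /x_ /s; ring.
  rewrite -[kappa * x]add0r; apply: cvg_near_eq (cvgD h2 h1).
  by apply: nearW => n /=; exact: subrK.
have sE : \forall n \near \oo, mode (a n) (b n) + scale (a n) (b n) * x_ n = s n.
  apply: filterS near_gt0 => n /andP[a0 b0].
  by rewrite /x_ mulrC divfK ?gt_eqF ?scale_gt0//; ring.
have s01 : \forall n \near \oo, 0 < s n < 1.
  by apply: filterS2 sE (near_mode_scale aoo boo xx) => n ->.
split => //; apply: cvg_near_eq (binomial_clt aoo boo xx); near=> n.
have [nE rE] : n = (a n + b n).+1 /\ r n = (a n).+1 by near: n.
rewrite unif_cdf_id; last by near: n.
rewrite /binG (_ : mode _ _ + _ = s n); last by near: n.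
by rewrite -nE -rE.
Unshelve. all: by end_near. Qed.

End sequences.

Section regimes.
Variable k : nat -> nat.
Hypothesis hk : forall n : nat, (0 < n)%N -> (1 <= k n <= n)%N.

Lemma cvg_predn : k n @[n --> \oo] --> \oo -> (k n).-1 @[n --> \oo] --> \oo.
Proof.
move=> koo; apply: (@cvg_nat_pinfty R) => m.
by apply: filterS (near_leq m.+1 koo) => n; lia.
Qed.

Let invn0 : (n%:R^-1 : R) @[n --> \oo] --> (0 : R).
Proof. by apply: cvg_invn; apply/(@cvgrnyP R); exact: cvgr_idn. Qed.

Lemma near_half : ((k n)%:R / n%:R : R) @[n --> \oo] --> (0 : R) ->
  \forall n \near \oo, ((k n).*2 <= n)%N.
Proof.
move=> kn0; near=> n.
have n0 : 0 < n%:R :> R by rewrite ltr0n; near: n; exact: near_posn.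
have : (k n)%:R / n%:R <= 2^-1 :> R.
  by near: n; apply: near_cvg0_le => //; rewrite invr_gt0.
by rewrite ler_pdivrMr// mulrC ler_pdivlMr// -natrM ler_nat muln2.
Unshelve. all: by end_near. Qed.

Lemma cvg_subn : ((k n)%:R / n%:R : R) @[n --> \oo] --> (0 : R) ->
  (n - k n)%N @[n --> \oo] --> \oo.
Proof.
move=> kn0; apply: (@cvg_nat_pinfty R) => m; near=> n.
have h : ((k n).*2 <= n)%N by near: n; exact: near_half.
have : (m.*2 <= n)%N by near: n; exact: nbhs_infty_ge.
lia.
Unshelve. all: by end_near. Qed.

Lemma ratio_extreme : k n @[n --> \oo] --> \oo ->
  ((k n)%:R / n%:R : R) @[n --> \oo] --> (0 : R) ->
  (n%:R / Num.sqrt (k n)%:R)^-1 / scale (k n).-1 (n - k n) @[n --> \oo] --> (1 : R).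
Proof.
move=> koo kn0.
(* The squared ratio (n - 1)^3 k / (n^2 (k - 1) (n - k)), written in terms of 1/k, 1/n and k/n. *)
apply: (@cvg_near_eq _ (fun n => Num.sqrt ((1 - (k n)%:R^-1)^-1 *
   ((1 - n%:R^-1) * (1 - n%:R^-1) * (1 - n%:R^-1)) * (1 - (k n)%:R / n%:R)^-1))).
  near=> n.
  have n0 : (0 < n)%N by near: n; exact: near_posn.
  have /andP[_ kn] := hk n0.
  have k1 : (1 < k n)%N by near: n; exact: near_leq.
  have k2 : ((k n).*2 <= n)%N by near: n; exact: near_half.
  have N0 : 0 < n%:R :> R by rewrite ltr0n.
  have K0 : 1 < (k n)%:R :> R by rewrite ltr1n.
  have K2 : 2 * (k n)%:R <= n%:R :> R by rewrite -natrM ler_nat mul2n.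
  rewrite div_scale; [|lia|lia|by rewrite invr_ge0 divr_ge0// sqrtr_ge0].
  congr (Num.sqrt _); rewrite invf_div expr_div_n sqr_sqrtr; last by lra.
  rewrite natrB// -subn1 natrB; last by lia.
  field.
  by rewrite !gt_eqF//; lra.
rewrite [X in _ --> X](_ : 1 = Num.sqrt ((1 - 0)^-1 * ((1 - 0) * (1 - 0) * (1 - 0)) * (1 - 0)^-1) :> R).
  apply: cvg_sqrt; apply: cvgM; first apply: cvgM.
  - by apply: cvgV; [rewrite subr0 oner_eq0|apply: cvgB; [exact: cvg_cst|exact: cvg_invn]].
  - by do 2?apply: cvgM; apply: cvgB => //; exact: cvg_cst.
  - by apply: cvgV; [rewrite subr0 oner_eq0|apply: cvgB => //; exact: cvg_cst].
by rewrite !subr0 invr1 !mulr1 sqrtr1.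
Unshelve. all: by end_near. Qed.

Section central.
Variable lambda : R.
Hypothesis lam01 : 0 < lambda < 1.
Hypothesis kn : ((k n)%:R / n%:R : R) @[n --> \oo] --> lambda.

(** Halving leaves room for the strict inequalities by which k - 1 and n - k eventually exceed c0
    n. *)
Let c0 : R := Num.min lambda (1 - lambda) / 2.

Let c0_gt0 : 0 < c0.
Proof.
case/andP: lam01 => l0 l1.
by rewrite /c0 divr_gt0// lt_min l0 subr_gt0.
Qed.

Let near_central : \forall n \near \oo,
  c0 * n%:R <= (k n).-1%:R /\ c0 * n%:R <= (n - k n)%:R.
Proof.
case/andP: lam01 => l0 l1.
have h1 : (k n)%:R / n%:R - n%:R^-1 @[n --> \oo] --> lambda - 0 by apply: cvgB.
have h2 : 1 - (k n)%:R / n%:R @[n --> \oo] --> 1 - lambda.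
  by apply: cvgB => //; exact: cvg_cst.
have c1 : c0 < lambda - 0.
  have : Num.min lambda (1 - lambda) <= lambda by rewrite ge_min lexx.
  by rewrite /c0; lra.
have c2 : c0 < 1 - lambda.
  have : Num.min lambda (1 - lambda) <= 1 - lambda by rewrite ge_min lexx orbT.
  by rewrite /c0; lra.
near=> n.
have n0 : (0 < n)%N by near: n; exact: near_posn.
have /andP[k1 k2] := hk n0.
have N0 : 0 < n%:R :> R by rewrite ltr0n.
split; rewrite -ler_pdivlMr//.
  rewrite -subn1 natrB// mulrBl mul1r ltW//; near: n.
  exact: (cvgr_gt _ h1).
rewrite natrB// mulrBl divff ?gt_eqF// ltW//; near: n.
exact: (cvgr_gt _ h2).
Unshelve. all: by end_near. Qed.

Let cvg_ge_linear (a : nat -> nat) : (\forall n \near \oo, c0 * n%:R <= (a n)%:R) ->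
  a n @[n --> \oo] --> \oo.
Proof.
move=> ha; apply/(@cvgrnyP R); apply/cvgryPge => B; near=> n.
have h : B / c0 <= n%:R :> R.
  by near: n; have /cvgryPge := @cvgr_idn R; apply.
rewrite (le_trans (_ : B <= c0 * n%:R))//; last by near: n.
by rewrite mulrC -ler_pdivrMr.
Unshelve. all: by end_near. Qed.

Lemma central_predn : (k n).-1 @[n --> \oo] --> \oo.
Proof. by apply: cvg_ge_linear; apply: filterS near_central => n []. Qed.

Lemma central_subn : (n - k n)%N @[n --> \oo] --> \oo.
Proof. by apply: cvg_ge_linear; apply: filterS near_central => n []. Qed.

Lemma central_dominates (j : nat -> nat) :
  ((j n)%:R / n%:R : R) @[n --> \oo] --> (0 : R) ->
  ((j n)%:R / (minn (k n).-1 (n - k n))%:R : R) @[n --> \oo] --> (0 : R).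
Proof.
move=> jn0; apply: (@squeeze0 _ _ (fun n => c0^-1 * ((j n)%:R / n%:R))).
  near=> n.
  have [h1 h2] : c0 * n%:R <= (k n).-1%:R /\ c0 * n%:R <= (n - k n)%:R by near: n.
  have n0 : 0 < n%:R :> R by rewrite ltr0n; near: n; exact: near_posn.
  have h : c0 * n%:R <= (minn (k n).-1 (n - k n))%:R.
    by rewrite /minn; case: ifP.
  have cn : 0 < c0 * n%:R by exact: mulr_gt0.
  rewrite divr_ge0//= mulrCA -invfM ler_wpM2l// lef_pV2 ?posrE//.
  exact: lt_le_trans h.
by rewrite -(mulr0 c0^-1); exact: cvgMl_tmp.
Unshelve. all: by end_near. Qed.

Lemma ratio_central :
  (Num.sqrt n%:R)^-1 / scale (k n).-1 (n - k n) @[n --> \oo] -->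
  (Num.sqrt (lambda * (1 - lambda)))^-1.
Proof.
case/andP: lam01 => l0 l1.
apply: (@cvg_near_eq _ (fun n => Num.sqrt (
   ((1 - n%:R^-1) * (1 - n%:R^-1) * (1 - n%:R^-1)) *
   (((k n)%:R / n%:R - n%:R^-1) * (1 - (k n)%:R / n%:R))^-1))).
  near=> n.
  have n0 : (0 < n)%N by near: n; exact: near_posn.
  have /andP[_ kln] := hk n0.
  have a1 : (0 < (k n).-1)%N by near: n; apply: near_leq; exact: central_predn.
  have b1 : (0 < n - k n)%N by near: n; apply: near_leq; exact: central_subn.
  have N0 : 0 < n%:R :> R by rewrite ltr0n.
  have K0 : 1 < (k n)%:R :> R by rewrite ltr1n; lia.
  have K2 : (k n)%:R < n%:R :> R by rewrite ltr_nat; lia.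
  rewrite div_scale//.
  congr (Num.sqrt _); rewrite exprVn sqr_sqrtr; last by lra.
  rewrite natrB// -subn1 natrB; last by lia.
  field.
  by rewrite !gt_eqF//; lra.
rewrite (_ : (Num.sqrt (lambda * (1 - lambda)))^-1 =
  Num.sqrt (((1 - 0) * (1 - 0) * (1 - 0)) * ((lambda - 0) * (1 - lambda))^-1)).
  apply: cvg_sqrt; apply: cvgM.
    by do 2?apply: cvgM; apply: cvgB => //; exact: cvg_cst.
  apply: cvgV; first by rewrite subr0 mulf_neq0// gt_eqF// subr_gt0.
  by apply: cvgM; apply: cvgB => //; exact: cvg_cst.
by rewrite !subr0 !mul1r sqrtrV// mulr_ge0// ltW// subr_gt0.
Unshelve. all: by end_near. Qed.

End central.

End regimes.

End scaling.

(** * Distribution functions of the order statistics *)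

Section order_statistic_events.
Context {R : realType} {d : measure_display} {T : measurableType d}.
Variable P : probability T R.

Lemma measurable_order_stat (X : nat -> {RV P >-> R}) (r n : nat) :
  measurable_fun setT (order_stat X r n).
Proof.
have [rn|nr] := ltnP r.-1 n; last first.
  (* Out of range, [nth] returns its default 0. *)
  rewrite (_ : order_stat X r n = cst 0); first exact: measurable_cst.
  by apply/funext => w; rewrite /order_stat nth_default// size_sort size_map size_iota.
apply: (measurability (@RGenOInfty.G R)) => [|_ [_ [x ->] <-]].
  exact: RGenOInfty.measurableE.
(* Rank 0 reads the same entry as rank 1, hence [r.-1.+1]. *)
rewrite setTI (_ : _ @^-1` _ =
    ~` [set w | (r.-1.+1 <= count_le X x n w)%N && (0 <= count_le X x n w)%N]).
  apply: measurableC.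
  exact: (measurable_counting_event X X x x
    (fun i j => (r.-1.+1 <= i)%N && (0 <= j)%N)).
apply/seteqP; split => w /=; rewrite in_itv/= andbT -(@order_stat_le _ _ X r.-1.+1)//.
  by rewrite ltNge => /negP h; rewrite andbT.
by rewrite andbT => /negP; rewrite -ltNge.
Qed.

Lemma measurable_scaled_pair (X Y : nat -> {RV P >-> R}) (r r' n : nat) (al be mu nu : R) :
  measurable_fun setT (fun w =>
    (al * (order_stat X r n w - mu), be * (order_stat Y r' n w - nu))).
Proof.
have aux (Z : nat -> {RV P >-> R}) s c e :
    measurable_fun setT (fun w => c * (order_stat Z s n w - e)).
  apply: measurable_funM; first exact: measurable_cst.
  apply: measurable_funB; last exact: measurable_cst.
  exact: measurable_order_stat.
by apply: measurable_fun_pair; exact: aux.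
Qed.

Lemma joint_cdf_order_stat (C : R * R -> R) (U V : nat -> {RV P >-> R})
    (n r r' : nat) (al be mu nu : R) (q : R * R) :
  is_copula C ->
  (forall i p, joint_cdf P (fun w => (U i w, V i w)) p = (C p)%:E) ->
  mutually_independent P (fun i w => (U i w, V i w)) ->
  (0 < r <= n)%N -> (0 < r' <= n)%N -> 0 < al -> 0 < be ->
  joint_cdf P (fun w =>
    (al * (order_stat U r n w - mu), be * (order_stat V r' n w - nu))) q =
  (binE2 (copula_cell C (mu + al^-1 * q.1) (nu + be^-1 * q.2)) n
     (fun a b => tail_ind r a * tail_ind r' b))%:E.
Proof.
move=> hC UVC ind rn rn' al0 be0.
have cellE i a b := copula_cellP hC (UVC i) (mu + al^-1 * q.1) (nu + be^-1 * q.2) a b.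
have := counting_law cellE ind (fun a b => (r <= a)%N && (r' <= b)%N) n.
have -> : (fun i j => ((r <= i)%N && (r' <= j)%N)%:R) =
    (fun a b => tail_ind r a * tail_ind r' b) :> (nat -> nat -> R).
  by apply/funext => i; apply/funext => j; rewrite /tail_ind -natrM mulnb.
move=> <-; rewrite /joint_cdf; congr (P _).
have shift (c z m x : R) : 0 < c -> (c * (z - m) <= x) = (z <= m + c^-1 * x).
  by move=> c0; rewrite mulrC -ler_pdivlMr// lerBlDl mulrC.
apply/seteqP; split => w /=; rewrite !shift// !order_stat_le//.
  by move=> [-> ->].
by move=> /andP[].
Qed.

End order_statistic_events.

(** * Distribution functions of the limit vectors *)

Section target.
Context {R : realType} {d : measure_display} {T : measurableType d}.
Variable P : probability T R.

Lemma independent_joint_cdf {I : choiceType} (W : I -> T -> R) (i j : I) (q : R * R) :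
  mutually_independent P W -> i != j ->
  joint_cdf P (fun w => (W i w, W j w)) q =
  (P [set w | W i w <= q.1]%R * P [set w | W j w <= q.2]%R)%E.
Proof.
move=> ind ij; pose A k : set R := if k == i then [set` `]-oo, q.1]] else [set` `]-oo, q.2]].
have mA k : measurable (A k) by rewrite /A; case: ifP => _; exact: measurable_itv.
have uij : uniq [:: i; j] by rewrite /= inE ij.
have := ind _ A uij mA; rewrite !big_cons big_nil mule1 /A eqxx.
rewrite eq_sym (negbTE ij) => e.
have halfE k c : [set w | W k w <= c] = W k @^-1` [set` `]-oo, c]].
  by apply/seteqP; split => w /=; rewrite in_itv.
rewrite !halfE -e /joint_cdf; congr (P _); apply/seteqP; split => w.
  move=> [h1 h2] k; rewrite /= inE mem_seq1 /A; case: eqP => [-> _|_ /= /eqP ->];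
    by rewrite /= in_itv.
move=> h; split.
  by have := h i (mem_head _ _); rewrite /= eqxx /= in_itv.
have jm : [set` [:: i; j]] j by rewrite /= inE mem_seq1 eqxx orbT.
by have := h j jm; rewrite /= eq_sym (negbTE ij) /= in_itv.
Qed.

Lemma joint_cdf_scale (X Z : T -> R) (c : R) (q : R * R) : 0 < c ->
  joint_cdf P (fun w => (c * X w, Z w)) q =
  joint_cdf P (fun w => (X w, Z w)) (c^-1 * q.1, q.2).
Proof.
move=> c0; rewrite /joint_cdf; congr (P _); apply/seteqP.
by split => w /=; rewrite -[X in X <= q.1]mulrC -ler_pdivlMr// mulrC.
Qed.

End target.

(** * Limits of joint tail probabilities under a copula *)

Section copula_limits.
Context {R : realType} {d : measure_display} {T : measurableType d}.
Variables (P : probability T R) (U V : {RV P >-> R}) (C : R * R -> R).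
Hypothesis hC : is_copula C.
Hypothesis UV_C : forall p, joint_cdf P (fun w => (U w, V w)) p = (C p)%:E.

Notation Phi x := (fine (normal_prob 0 1 `]-oo, x])).

Lemma unif_cdf01 (s : R) : 0 <= unif_cdf s <= 1.
Proof.
have m : measurable ([set` `]-oo, s]] : set (measurableTypeR R)) by exact: measurable_itv.
by rewrite /unif_cdf fine_ge0 ?measure_ge0//= -lee_fin fineK_probability// probability_le1.
Qed.

Let cell_ge0 s t a b := copula_cell_ge0 hC UV_C s t a b.

Lemma copula_tail_limit (s t : nat -> R) (r r' : nat -> nat) (l l' : R) :
  (forall e, 0 < e -> \forall n \near \oo, exists w w', [/\ (0 < w)%N, (0 < w')%N &
    n%:R * `|C (s n, t n) - unif_cdf (s n) * unif_cdf (t n)| / (w%:R * w'%:R) +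
    (binE (unif_cdf (s n)) n (window (r n) w) +
     binE (unif_cdf (t n)) n (window (r' n) w')) *+ 2 <= e]) ->
  binE (unif_cdf (s n)) n (tail_ind (r n)) @[n --> \oo] --> l ->
  binE (unif_cdf (t n)) n (tail_ind (r' n)) @[n --> \oo] --> l' ->
  binE2 (copula_cell C (s n) (t n)) n (fun a b => tail_ind (r n) a * tail_ind (r' n) b)
    @[n --> \oo] --> l * l'.
Proof.
apply: joint_tail_limit => n //.
- exact: copula_cell_sum.
- by rewrite /copula_cell addrC subrK.
- by rewrite /copula_cell addrC subrK.
Qed.

Section first_coordinate.
Variables (a b r : nat -> nat) (c : nat -> R) (kappa x : R).
Hypotheses (aoo : a n @[n --> \oo] --> \oo) (boo : b n @[n --> \oo] --> \oo).
Hypothesis nE : \forall n \near \oo, n = (a n + b n).+1 /\ r n = (a n).+1.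
Hypothesis ck : c n / scale (a n) (b n) @[n --> \oo] --> kappa.

Lemma copula_limit_extreme (j : nat) (y : R) : (0 < j)%N ->
  binE2 (copula_cell C ((r n)%:R / (n + 1)%:R + c n * x) (1 + n%:R^-1 * y)) n
    (fun a b => tail_ind (r n) a * tail_ind (n - j + 1) b)
    @[n --> \oo] --> Phi (kappa * x) * neg_gamma_cdf j y.
Proof.
(* The eventual mean number of V_i above the level. For y > 0 the level exceeds 1 and this number is
   0. *)
move=> j0; pose lam := Num.max (- y) 0.
have lam0 : 0 <= lam by rewrite /lam le_max lexx orbT.
have vE : \forall n \near \oo, unif_cdf (1 + n%:R^-1 * y) = 1 - lam / n%:R.
  near=> n.
  have n0 : 0 < n%:R :> R by rewrite ltr0n; near: n; exact: near_posn.
  have ni : 0 < n%:R^-1 :> R by rewrite invr_gt0.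
  have [y0|y0] := leP 0 y.
    rewrite /lam (max_idPr _) ?oppr_le0// mul0r subr0 unif_cdf_ge1//.
    by rewrite lerDl mulr_ge0// ltW.
  rewrite /lam (max_idPl _) ?oppr_ge0 ?(ltW y0)// unif_cdf_id; first by ring.
  have h : - y / n%:R <= 2^-1.
    near: n; apply: near_cvg0_le; last by rewrite invr_gt0.
    rewrite -(mulr0 (- y)); apply: cvgMl_tmp; apply: cvg_invn.
    by apply/(@cvgrnyP R); exact: cvgr_idn.
  have h' : n%:R^-1 * y < 0 by rewrite pmulr_rlt0.
  by apply/andP; split; lra.
apply: copula_tail_limit.
- apply: (@small_error_poisson _ _ _ _ _ _ a b lam) => //.
    by move=> n; exact: unif_cdf01.
  near=> n.
  have n0 : 0 < n%:R :> R by rewrite ltr0n; near: n; exact: near_posn.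
  have v : unif_cdf (1 + n%:R^-1 * y) = 1 - lam / n%:R by near: n.
  have := copula_cov_le hC UV_C ((r n)%:R / (n + 1)%:R + c n * x) (1 + n%:R^-1 * y).
  have -> : 1 - unif_cdf (1 + n%:R^-1 * y) = lam / n%:R by rewrite v; ring.
  move=> h.
  by have := ler_wpM2l (ltW n0) h; rewrite mulrCA divff ?mulr1// gt_eqF.
- exact: (normal_margin aoo boo x nE ck).2.
- have -> : neg_gamma_cdf j y = expR (- lam) * \sum_(0 <= i < j) lam ^+ i / i`!%:R.
    rewrite /neg_gamma_cdf; case: leP => y0.
      by rewrite /lam (max_idPl _) ?oppr_ge0// opprK.
    rewrite /lam (max_idPr _) ?oppr_le0 ?(ltW y0)// oppr0 expR0 mul1r.
    rewrite big_ltn// big_nat big1 ?addr0 ?expr0 ?fact0 ?divr1// => i /andP[i0 _].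
    by rewrite expr0n gtn_eqF// mul0r.
  apply: (@cvg_near_eq _ (fun n => binE (1 - lam / n%:R) n (tail_ind (n - j + 1)))).
    by apply: filterS vE => n ->.
  exact: poisson_limit.
Unshelve. all: by end_near. Qed.

Lemma copula_limit_intermediate (j : nat -> nat) (y : R) :
  (forall n : nat, (0 < n)%N -> (1 <= j n <= n)%N) ->
  j n @[n --> \oo] --> \oo ->
  ((j n)%:R / n%:R : R) @[n --> \oo] --> (0 : R) ->
  ((j n)%:R / (minn (a n) (b n))%:R : R) @[n --> \oo] --> (0 : R) ->
  binE2 (copula_cell C ((r n)%:R / (n + 1)%:R + c n * x)
      ((n - j n + 1)%:R / (n + 1)%:R + (n%:R / Num.sqrt (j n)%:R)^-1 * y)) n
    (fun a b => tail_ind (r n) a * tail_ind (n - j n + 1) b)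
    @[n --> \oo] --> Phi (kappa * x) * Phi y.
Proof.
move=> hj joo jn0 jA.
pose a' n := (n - j n)%N; pose b' n := (j n).-1.
have aoo' : a' n @[n --> \oo] --> \oo by exact: (@cvg_subn R).
have boo' : b' n @[n --> \oo] --> \oo by exact: (@cvg_predn R).
have nE' : \forall n \near \oo, n = (a' n + b' n).+1 /\ (n - j n + 1)%N = (a' n).+1.
  near=> n; have n0 : (0 < n)%N by near: n; exact: near_posn.
  by have /andP[j1 j2] := hj n n0; rewrite /a' /b'; split; lia.
have ck' : (n%:R / Num.sqrt (j n)%:R)^-1 / scale (a' n) (b' n) @[n --> \oo] --> (1 : R).
  apply: cvg_near_eq (ratio_extreme hj joo jn0).
  by apply: nearW => n; rewrite scaleC.
have [t01 tlim] := normal_margin aoo' boo' y nE' ck'.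
rewrite mul1r in tlim.
have minE : \forall n \near \oo, minn (a' n) (b' n) = (j n).-1.
  near=> n; have h : ((j n).*2 <= n)%N by near: n; exact: (@near_half R).
  by rewrite /a' /b'; lia.
apply: copula_tail_limit => //; last exact: (normal_margin aoo boo x nE ck).2.
(* n (1 - t) is at most (1 + |y|) j, and the factor 2 comes from j <= 2 (j - 1), the minimum on the
   second side being j - 1. *)
apply: (@small_error_normal _ _ _ _ _ _ a b a' b' (2 * (1 + `|y|))) => //.
- by move=> n; exact: unif_cdf01.
- by move=> n; exact: unif_cdf01.
- near=> n.
  have n0 : (0 < n)%N by near: n; exact: near_posn.
  have N0 : 0 < n%:R :> R by rewrite ltr0n.
  have j2 : (2 <= j n)%N by near: n; exact: near_leq.
  have /andP[_ jn] := hj n n0.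
  rewrite (_ : minn (a' n) (b' n) = (j n).-1); last by near: n.
  have : 0 < (n - j n + 1)%:R / (n + 1)%:R + (n%:R / Num.sqrt (j n)%:R)^-1 * y < 1.
    by near: n; exact: t01.
  set t := (n - j n + 1)%:R / (n + 1)%:R + _ => t01n.
  have := copula_cov_le hC UV_C ((r n)%:R / (n + 1)%:R + c n * x) t.
  rewrite (unif_cdf_id t01n) => h; have {}h := ler_wpM2l (ltW N0) h.
  apply: (le_trans h).
  have J0 : 2 <= (j n)%:R :> R by rewrite ler_nat.
  have sj0 : 0 < Num.sqrt (j n)%:R :> R by rewrite sqrtr_gt0; lra.
  have sj : Num.sqrt (j n)%:R <= (j n)%:R :> R.
    have sj1 : 1 <= Num.sqrt (j n)%:R :> R by rewrite -[leLHS]sqrtr1 ler_wsqrtr//; lra.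
    by rewrite -[leRHS]sqr_sqrtr// expr2 ler_peMr// ltW.
  have -> : n%:R * (1 - t) = n%:R / (n%:R + 1) * (j n)%:R - Num.sqrt (j n)%:R * y.
    rewrite /t invf_div natrD natrB// [(n + 1)%:R]natrD; field.
    by rewrite !gt_eqF//; lra.
  have h1 : n%:R / (n%:R + 1) * (j n)%:R <= (j n)%:R :> R.
    by rewrite ler_piMl// ler_pdivrMr; lra.
  have h2 : - (Num.sqrt (j n)%:R * y) <= (j n)%:R * `|y|.
    rewrite -mulrN (le_trans (ler_norm _))// normrM normrN (ger0_norm (ltW sj0)).
    by rewrite ler_wpM2r.
  have h3 : (j n)%:R <= 2 * (j n).-1%:R :> R.
    by rewrite -natrM ler_nat; lia.
  have y0 : 0 <= 1 + `|y| by rewrite addr_ge0.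
  have := ler_wpM2l y0 h3; lra.
- apply: (@squeeze0 _ _ (fun n => (j n)%:R / (minn (a n) (b n))%:R)) => //.
  near=> n; rewrite divr_ge0//= ler_wpM2r ?invr_ge0// ler_nat.
  by rewrite (_ : minn (a' n) (b' n) = (j n).-1) ?leq_pred//; near: n.
Unshelve. all: by end_near. Qed.

End first_coordinate.

End copula_limits.

(** * Limits for order statistics *)

Section order_statistic_limits.
Context {R : realType} {d : measure_display} {T : measurableType d}.
Variables (C : R * R -> R) (P : probability T R) (U V : nat -> {RV P >-> R}).
Hypothesis hC : is_copula C.
Hypothesis UV_C : forall i p, joint_cdf P (fun w => (U i w, V i w)) p = (C p)%:E.
Hypothesis UV_indep : mutually_independent P (fun i w => (U i w, V i w)).
Variables (a b r : nat -> nat) (al : nat -> R) (kappa : R).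
Hypotheses (aoo : a n @[n --> \oo] --> \oo) (boo : b n @[n --> \oo] --> \oo).
Hypothesis nE : \forall n \near \oo, n = (a n + b n).+1 /\ r n = (a n).+1.
Hypothesis al_gt0 : \forall n \near \oo, 0 < al n.
Hypothesis alk : (al n)^-1 / scale (a n) (b n) @[n --> \oo] --> kappa.

Notation Phi x := (fine (normal_prob 0 1 `]-oo, x])).

Let r_bounds : \forall n \near \oo, (0 < r n <= n)%N.
Proof. by apply: filterS nE => n [h1 h2]; lia. Qed.

Lemma order_stat_limit_extreme (j : nat) (q : R * R) : (0 < j)%N ->
  joint_cdf P (fun w =>
    (al n * (order_stat U (r n) n w - (r n)%:R / (n + 1)%:R),
     n%:R * (order_stat V (n - j + 1) n w - 1))) q
  @[n --> \oo] --> (Phi (kappa * q.1) * neg_gamma_cdf j q.2)%:E.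
Proof.
move=> j0.
apply: (@cvg_near_eq _ (fun n => (binE2 (copula_cell C
    ((r n)%:R / (n + 1)%:R + (al n)^-1 * q.1) (1 + n%:R^-1 * q.2)) n
    (fun a b => tail_ind (r n) a * tail_ind (n - j + 1) b))%:E)).
  near=> n; apply/esym; apply: joint_cdf_order_stat => //.
  - by near: n.
  - have : (j <= n)%N by near: n; exact: nbhs_infty_ge.
    by lia.
  - by near: n.
  - by rewrite ltr0n; near: n; exact: near_posn.
apply: cvg_EFin; first exact: nearW.
exact: (copula_limit_extreme hC (UV_C 0%N) aoo boo nE alk j0).
Unshelve. all: by end_near. Qed.

Lemma order_stat_limit_intermediate (j : nat -> nat) (q : R * R) :
  (forall n : nat, (0 < n)%N -> (1 <= j n <= n)%N) ->
  j n @[n --> \oo] --> \oo ->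
  ((j n)%:R / n%:R : R) @[n --> \oo] --> (0 : R) ->
  ((j n)%:R / (minn (a n) (b n))%:R : R) @[n --> \oo] --> (0 : R) ->
  joint_cdf P (fun w =>
    (al n * (order_stat U (r n) n w - (r n)%:R / (n + 1)%:R),
     n%:R / Num.sqrt (j n)%:R *
       (order_stat V (n - j n + 1) n w - (n - j n + 1)%:R / (n + 1)%:R))) q
  @[n --> \oo] --> (Phi (kappa * q.1) * Phi q.2)%:E.
Proof.
move=> hj joo jn0 jA.
apply: (@cvg_near_eq _ (fun n => (binE2 (copula_cell C
    ((r n)%:R / (n + 1)%:R + (al n)^-1 * q.1)
    ((n - j n + 1)%:R / (n + 1)%:R + (n%:R / Num.sqrt (j n)%:R)^-1 * q.2)) n
    (fun a b => tail_ind (r n) a * tail_ind (n - j n + 1) b))%:E)).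
  near=> n.
  have n0 : (0 < n)%N by near: n; exact: near_posn.
  have jn := hj n n0.
  apply/esym; apply: joint_cdf_order_stat => //.
  - by near: n.
  - by lia.
  - by near: n.
  - by rewrite divr_gt0 ?sqrtr_gt0 ?ltr0n//; lia.
apply: cvg_EFin; first exact: nearW.
exact: (copula_limit_intermediate hC (UV_C 0%N) aoo boo nE alk hj).
Unshelve. all: by end_near. Qed.

End order_statistic_limits.

Theorem theorem3p1 (R : realType) (C : R * R -> R) (hC : is_copula C)
  (d : measure_display) (T : measurableType d) (P : probability T R)
  (U V : nat -> {RV P >-> R})
  (hUV_cdf : forall i p, joint_cdf P (fun w => (U i w, V i w)) p = (C p)%:E)
  (hUV_indep : mutually_independent P (fun i w => (U i w, V i w)))
  (d' : measure_display) (T' : measurableType d') (P' : probability T' R)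
  (X Y : {RV P' >-> R}) (eta : nat -> {RV P' >-> R})
  (hX : has_law X (normal_prob 0 1))
  (hY : has_law Y (normal_prob 0 1))
  (heta : forall j : nat, (0 < j)%N ->
     forall x : R, cdf (eta j) x = (neg_gamma_cdf j x)%:E)
  (hindep : forall j : nat, (0 < j)%N ->
     mutually_independent P'
       (fun i : 'I_3 =>
          tnth [tuple (X : T' -> R); (Y : T' -> R); (eta j : T' -> R)] i))
  (k : nat -> nat)
  (hk : forall n : nat, (0 < n)%N -> (1 <= k n <= n)%N) :
  (* (i) *)
  ((k n @[n --> \oo] --> \oo) ->
   ((k n)%:R / n%:R : R) @[n --> \oo] --> (0 : R) ->
   forall j : nat, (0 < j)%N ->
   cvg_in_distribution P
     (fun n w =>
        (n%:R / Num.sqrt (k n)%:R *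
           (order_stat U (n - k n + 1) n w - (n - k n + 1)%:R / (n + 1)%:R),
         n%:R * (order_stat V (n - j + 1) n w - 1)))
     P' (fun w => (X w, eta j w)))
  /\
  (* (ii) *)
  ((k n @[n --> \oo] --> \oo) ->
   ((k n)%:R / n%:R : R) @[n --> \oo] --> (0 : R) ->
   forall j : nat, (0 < j)%N ->
   cvg_in_distribution P
     (fun n w =>
        (n%:R / Num.sqrt (k n)%:R *
           (order_stat U (k n) n w - (k n)%:R / (n + 1)%:R),
         n%:R * (order_stat V (n - j + 1) n w - 1)))
     P' (fun w => (X w, eta j w)))
  /\
  (* (iii) *)
  (forall lambda : R, 0 < lambda < 1 ->
   ((k n)%:R / n%:R : R) @[n --> \oo] --> lambda ->
   forall j : nat, (0 < j)%N ->
   cvg_in_distribution P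
     (fun n w =>
        (Num.sqrt n%:R * (order_stat U (k n) n w - (k n)%:R / (n + 1)%:R),
         n%:R * (order_stat V (n - j + 1) n w - 1)))
     P' (fun w => (Num.sqrt (lambda * (1 - lambda)) * X w, eta j w)))
  /\
  (* (iv) *)
  (forall lambda : R, 0 < lambda < 1 ->
   ((k n)%:R / n%:R : R) @[n --> \oo] --> lambda ->
   forall j : nat -> nat,
   (forall n : nat, (0 < n)%N -> (1 <= j n <= n)%N) ->
   (j n @[n --> \oo] --> \oo) ->
   ((j n)%:R / n%:R : R) @[n --> \oo] --> (0 : R) ->
   cvg_in_distribution P
     (fun n w =>
        (Num.sqrt n%:R * (order_stat U (k n) n w - (k n)%:R / (n + 1)%:R),
         n%:R / Num.sqrt (j n)%:R *
           (order_stat V (n - j n + 1) n w - (n - j n + 1)%:R / (n + 1)%:R)))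
     P' (fun w => (Num.sqrt (lambda * (1 - lambda)) * X w, Y w)))
  /\
  (* (v) *)
  ((k n @[n --> \oo] --> \oo) ->
   ((k n)%:R / n%:R : R) @[n --> \oo] --> (0 : R) ->
   forall j : nat -> nat,
   (forall n : nat, (0 < n)%N -> (1 <= j n <= n)%N) ->
   (j n @[n --> \oo] --> \oo) ->
   ((j n)%:R / n%:R : R) @[n --> \oo] --> (0 : R) ->
   ((j n)%:R / Num.sqrt (k n)%:R : R) @[n --> \oo] --> (0 : R) ->
   cvg_in_distribution P
     (fun n w =>
        (n%:R / Num.sqrt (k n)%:R *
           (order_stat U (n - k n + 1) n w - (n - k n + 1)%:R / (n + 1)%:R),
         n%:R / Num.sqrt (j n)%:R *
           (order_stat V (n - j n + 1) n w - (n - j n + 1)%:R / (n + 1)%:R)))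
     P' (fun w => (X w, Y w))).
Proof.
pose Phi (x : R) : R := fine (normal_prob 0 1 `]-oo, x]).
have law (W : {RV P' >-> R}) c : has_law W (normal_prob 0 1) ->
    P' [set w | W w <= c] = (Phi c)%:E.
  by move=> lW; rewrite /Phi -(has_law_le c lW) fineK_probability//; exact: measurable_rv_le.
pose W j : 'I_3 -> T' -> R :=
  fun i => tnth [tuple (X : T' -> R); (Y : T' -> R); (eta j : T' -> R)] i.
have XY q : joint_cdf P' (fun w => (X w, Y w)) q = (Phi q.1 * Phi q.2)%:E.
  have i01 : (@Ordinal 3 0 isT) != (@Ordinal 3 1 isT) by [].
  rewrite EFinM -(law X q.1 hX) -(law Y q.2 hY).
  (* Independence is given for triples with a positive index; index 1 serves for the pair of [X] and
     [Y]. *)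
  exact: (independent_joint_cdf q (hindep 1%N isT) i01).
have Xeta j q : (0 < j)%N ->
    joint_cdf P' (fun w => (X w, eta j w)) q = (Phi q.1 * neg_gamma_cdf j q.2)%:E.
  move=> j0; have i02 : (@Ordinal 3 0 isT) != (@Ordinal 3 2 isT) by [].
  rewrite EFinM -(law X q.1 hX) -heta//.
  exact: (independent_joint_cdf q (hindep j j0) i02).
have mpair c (Z : {RV P' >-> R}) : measurable_fun setT (fun w => (c * X w, Z w)).
  apply: measurable_fun_pair; last exact: measurable_funPT.
  by apply: measurable_funM; [exact: measurable_cst|exact: measurable_funPT].
have mpair1 (Z : {RV P' >-> R}) : measurable_fun setT (fun w => (X w, Z w)).
  by apply: measurable_fun_pair; exact: measurable_funPT.
have scale_k : \forall n \near \oo, 0 < n%:R / Num.sqrt (k n)%:R :> R.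
  near=> n; have n0 : (0 < n)%N by near: n; exact: near_posn.
  by rewrite divr_gt0 ?sqrtr_gt0 ?ltr0n//; have := hk n n0; lia.
have scale_sqrt : \forall n \near \oo, 0 < Num.sqrt n%:R :> R.
  by near=> n; rewrite sqrtr_gt0 ltr0n; near: n; exact: near_posn.
(* A rank r corresponds to a = r - 1 and b = n - r; passing from rank k to rank n - k + 1 exchanges
   the two. *)
have low : \forall n \near \oo, n = ((k n).-1 + (n - k n)).+1 /\ k n = (k n).-1.+1.
  near=> n; have n0 : (0 < n)%N by near: n; exact: near_posn.
  by have := hk n n0; split; lia.
have high : \forall n \near \oo,
    n = ((n - k n) + (k n).-1).+1 /\ (n - k n + 1)%N = (n - k n).+1.
  near=> n; have n0 : (0 < n)%N by near: n; exact: near_posn.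
  by have := hk n n0; split; lia.
have ratio_high : (k n @[n --> \oo] --> \oo) ->
    ((k n)%:R / n%:R : R) @[n --> \oo] --> (0 : R) ->
    (n%:R / Num.sqrt (k n)%:R)^-1 / scale (n - k n) (k n).-1 @[n --> \oo] --> (1 : R).
  move=> koo kn0; apply: cvg_near_eq (ratio_extreme hk koo kn0).
  by apply: nearW => n; rewrite scaleC.
split; [|split; [|split; [|split]]].
- move=> koo kn0 j j0; split.
  + by move=> n; exact: measurable_scaled_pair.
  + exact: mpair1.
  move=> q _; rewrite Xeta// -(mul1r q.1).
  exact: (order_stat_limit_extreme hC hUV_cdf hUV_indep (cvg_subn kn0)
    (cvg_predn koo) high scale_k (ratio_high koo kn0) j0).
- move=> koo kn0 j j0; split.
  + by move=> n; exact: measurable_scaled_pair.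
  + exact: mpair1.
  move=> q _; rewrite Xeta// -(mul1r q.1).
  exact: (order_stat_limit_extreme hC hUV_cdf hUV_indep (cvg_predn koo)
    (cvg_subn kn0) low scale_k (ratio_extreme hk koo kn0) j0).
- move=> lambda lam01 kn j j0; split.
  + by move=> n; exact: measurable_scaled_pair.
  + exact: mpair.
  have s0 : 0 < Num.sqrt (lambda * (1 - lambda)).
    by case/andP: lam01 => l0 l1; rewrite sqrtr_gt0 mulr_gt0// subr_gt0.
  (* The factor of [X] moves into the argument, where its inverse is the limit of the norming
     ratio. *)
  move=> q _; rewrite joint_cdf_scale// Xeta//.
  exact: (order_stat_limit_extreme hC hUV_cdf hUV_indep
    (central_predn hk lam01 kn) (central_subn hk lam01 kn) low scale_sqrt
    (ratio_central hk lam01 kn) j0).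
- move=> lambda lam01 kn j hj joo jn0; split.
  + by move=> n; exact: measurable_scaled_pair.
  + exact: mpair.
  have s0 : 0 < Num.sqrt (lambda * (1 - lambda)).
    by case/andP: lam01 => l0 l1; rewrite sqrtr_gt0 mulr_gt0// subr_gt0.
  move=> q _; rewrite joint_cdf_scale// XY.
  exact: (order_stat_limit_intermediate hC hUV_cdf hUV_indep
    (central_predn hk lam01 kn) (central_subn hk lam01 kn) low scale_sqrt
    (ratio_central hk lam01 kn) hj joo jn0 (central_dominates hk lam01 kn jn0)).
- move=> koo kn0 j hj joo jn0 jk0; split.
  + by move=> n; exact: measurable_scaled_pair.
  + exact: mpair1.
  (* The minimum is eventually k - 1, and sqrt k <= k <= 2 (k - 1). *)
  have jk : ((j n)%:R / (minn (n - k n) (k n).-1)%:R : R) @[n --> \oo] --> (0 : R).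
    apply: (@squeeze0 _ _ (fun n => 2 * ((j n)%:R / Num.sqrt (k n)%:R))); last first.
      by rewrite -(mulr0 2); exact: cvgMl_tmp.
    near=> n.
    have k2 : (2 <= k n)%N by near: n; exact: near_leq.
    have kn2 : ((k n).*2 <= n)%N by near: n; exact: (near_half kn0).
    have -> : minn (n - k n) (k n).-1 = (k n).-1 by lia.
    have K2 : 2 <= (k n)%:R :> R by rewrite ler_nat.
    have s1 : 1 <= Num.sqrt (k n)%:R :> R by rewrite -[leLHS]sqrtr1 ler_wsqrtr//; lra.
    have sk : Num.sqrt (k n)%:R <= (k n)%:R :> R.
      by rewrite -[leRHS]sqr_sqrtr// expr2 ler_peMr// (le_trans ler01).
    have kp : (k n)%:R <= 2 * (k n).-1%:R :> R by rewrite -natrM ler_nat; lia.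
    rewrite divr_ge0//= mulrCA ler_wpM2l// ler_pdivlMr; last by lra.
    by rewrite mulrC ler_pdivrMr; lra.
  move=> q _; rewrite XY -(mul1r q.1).
  exact: (order_stat_limit_intermediate hC hUV_cdf hUV_indep (cvg_subn kn0)
    (cvg_predn koo) high scale_k (ratio_high koo kn0) hj joo jn0 jk).
Unshelve. all: by end_near. Qed.
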